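(* Let $M$ be a matroid (in the sense below) on ground set $E(M)$ which is finitary or co-finitary, and let $X$ and $Y$ be two disjoint subsets of $E(M)$. Then there exists a partition $(C,D)$ of $E(M)\setminus(X\cup Y)$ such that $\kappa_{M/C-D}(X,Y)=\kappa_M(X,Y)$.
   Context: Matroids may be infinite. A matroid is a pair $M=(E,\mathcal I)$ with $\mathcal I$ a set of subsets of $E$ (the independent sets) such that: (I1) $\emptyset\in\mathcal I$; (I2) $\mathcal I$ is closed under subsets; (I3) for every $I\in\mathcal I$ that is not $\subseteq$-maximal in $\mathcal I$ and every $\subseteq$-maximal $I'\in\mathcal I$ there is $x\in I'\setminus I$ with $I\cup\{x\}\in\mathcal I$; (IM) whenever $I\subseteq X\subseteq E$ and $I\in\mathcal I$, the set $\{I'\in\mathcal I: I\subseteq I'\subseteq X\}$ has a maximal element. Bases are maximal independent sets, circuits are minimal dependent sets. The dual $M^*$ is the matroid on $E$ whose bases are the complements of bases of $M$. For $X\subseteq E$, the restriction $M|X$ has as independent sets the independent sets of $M$ contained in $X$; $M-X:=M|(E\setminus X)$; the contraction is $M/X:=(M^*-X)^*$; for disjoint $C,D$, $M/C-D:=(M/C)-D$. $M$ is finitary if all its circuits are finite, and co-finitary if $M^*$ is finitary. For independent sets $I,J$ let $\mathrm{del}_M(I,J)$ be the minimum of $|F|$ over $F\subseteq I\cup J$ with $(I\cup J)\setminus F$ independent, or $\infty$ if no finite such $F$ exists. For $U\subseteq E$, $\kappa_M(U):=\mathrm{del}_M(B,B')$ where $B$ is any basis of $M|U$ and $B'$ any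 basis of $M-U$ (this does not depend on the choice of bases). For disjoint $X,Y\subseteq E$, $\kappa_M(X,Y):=\min\{\kappa_M(U): X\subseteq U\subseteq E\setminus Y\}$. *)

(* Defs.v *)
From mathcomp Require Import all_boot.
From mathcomp Require Import boolp classical_sets cardinality.

Set Implicit Arguments.
Unset Strict Implicit.
Unset Printing Implicit Defensive.

Local Open Scope classical_set_scope.

Section SetFamilies.
Variable T : Type.
Implicit Types (F : set (set T)) (A : set T).

Definition max_in F A := F A /\ forall B, F B -> A `<=` B -> B = A.
Definition min_in F A := F A /\ forall B, F B -> B `<=` A -> B = A.

End SetFamilies.

(* Elements of N u {oo} are encoded in [option nat], with [None] as oo.
   [min_inf A] is the minimum of A, or oo if A is empty. *)
Definition min_inf (A : set nat) : option nat :=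
  xget None [set k | exists2 n, k = Some n & A n /\ forall m, A m -> n <= m].

(* A pair (E, I), not yet assumed to satisfy any axiom, so that the dual,
   restriction and contraction can be defined on data alone. *)
Record indep_system (T : Type) := IndepSystem {
  ground : set T;
  indep : set (set T)
}.

Record is_matroid (T : Type) (M : indep_system T) : Prop := IsMatroid {
  indep_ground : forall I, indep M I -> I `<=` ground M;
  indep_set0 : indep M set0;
  indep_subset : forall I J, indep M J -> I `<=` J -> indep M I;
  indep_augment : forall I I', indep M I -> ~ max_in (indep M) I ->
    max_in (indep M) I' ->
    exists2 x, (I' `\` I) x & indep M (I `|` [set x]);
  indep_max : forall I X, indep M I -> I `<=` X -> X `<=` ground M ->
    exists J, max_in [set I' | [/\ indep M I', I `<=` I' & I' `<=` X]] J
}.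

Section MatroidNotions.
Variable T : Type.
Implicit Types (M : indep_system T) (X Y U B C D F I J : set T).

Definition basis M B := max_in (indep M) B.

Definition circuit M C :=
  min_in [set D | D `<=` ground M /\ ~ indep M D] C.

(* A set is independent in the dual iff it is contained in a dual basis,
   that is, in the complement of a basis; see [basis_dual] below. *)
Definition dual M : indep_system T :=
  IndepSystem (ground M)
    [set I | exists2 B, basis M B & I `<=` ground M `\` B].

(* Only meaningful for X included in the ground set. *)
Definition restrict M X : indep_system T :=
  IndepSystem X [set I | indep M I /\ I `<=` X].

Definition delete M X : indep_system T := restrict M (ground M `\` X).

Definition contract M X : indep_system T := dual (delete (dual M) X).

Definition finitary M := forall C, circuit M C -> finite_set C.

Definition cofinitary M := finitary (dual M).

Definition del M I J : option nat :=
  min_inf [set n | exists F, [/\ F `<=` I `|` J, (F #= `I_n)%card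
                               & indep M ((I `|` J) `\` F)]].

(* The common value of del_M(B, B') over all bases B of M|U and B' of M - U;
   such bases exist by [basis_restrict_ex] below. *)
Definition kappa M U : option nat :=
  xget None [set k | exists B B', [/\ basis (restrict M U) B,
                                      basis (delete M U) B'
                                    & k = del M B B']].

Definition kappa2 M X Y : option nat :=
  min_inf [set n | exists U, [/\ X `<=` U, U `<=` ground M `\` Y
                               & kappa M U = Some n]].

End MatroidNotions.

Lemma min_inf_None (A : set nat) : min_inf A = None <-> A = set0.
Proof.
rewrite /min_inf; split=> [|->]; last first.
  by case: xgetP => // k _ [n _ []].
case: xgetP => [k _ [n -> _] //|noA] _; apply/seteqP; split=> // n An.
have exA : exists n, `[< A n >] by exists n; exact/asboolP.
case: (ex_minnP exA) => m /asboolP Am minm.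
apply: (noA (Some m)); exists m => //; split=> // p Ap.
exact/minm/asboolP.
Qed.

Lemma min_inf_Some (A : set nat) n :
  min_inf A = Some n <-> A n /\ forall m, A m -> n <= m.
Proof.
rewrite /min_inf; split.
  by case: xgetP => // k _ [p -> ?] [<-].
move=> [An minn].
apply: xget_unique => [|k [p -> [Ap minp]]]; first by exists n.
by congr Some; apply/eqP; rewrite eqn_leq minp ?minn.
Qed.

Lemma basis_dual (T : Type) (M : indep_system T) (B : set T) : is_matroid M ->
  basis (dual M) B <-> B `<=` ground M /\ basis M (ground M `\` B).
Proof.
move=> mM; split.
- move=> [[B0 bB0 sB] maxB].
  have sB0 : B0 `<=` ground M by apply: (indep_ground mM); case: bB0.
  have <- : ground M `\` B0 = B by apply: maxB => //; exists B0.
  split; first by move=> x [].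
  by rewrite setDD setIidr.
- move=> [sB bB]; split; first by exists (ground M `\` B) => //; rewrite setDD setIidr.
  move=> J [B1 bB1 sJ] sBJ.
  have sB1 : B1 `<=` ground M `\` B.
    move=> x B1x; split; first by apply: (indep_ground mM) B1x; case: bB1.
    by move=> /sBJ/sJ [].
  have eB1 : ground M `\` B = B1 by apply: (proj2 bB1) => //; exact: (proj1 bB).
  by apply/seteqP; split=> // x /sJ; rewrite -eB1 setDD => -[].
Qed.

Lemma basis_restrict_ex (T : Type) (M : indep_system T) (U : set T) :
  is_matroid M -> U `<=` ground M -> exists B, basis (restrict M U) B.
Proof.
move=> mM sU.
have [B [[iB _ sB] maxB]] := indep_max mM (indep_set0 mM) (@sub0set _ _) sU.
by exists B; split=> // J [iJ sJ] sBJ; apply: maxB => //; split.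
Qed.

(* Main.v *)
(** By duality M may be assumed finitary. Then connectivity is witnessed by ranks of finite
    sets: kappa(U) >= k iff there are finite A in U and B in E - U with
    r(A) + r(B) - r(A u B) >= k. If kappa(X, Y) >= k, compactness gives a finite Z such that
    every separation of X from Y already has order at least k inside Z, and Tutte's linking
    theorem in M|Z gives a finite independent C such that contracting C keeps connectivity k
    between finite parts of X and Y; connectivity never increases in a minor. If
    kappa(X, Y) is infinite, the argument is iterated: after contracting a finite link
    together with its witnesses in X and Y the connectivity is still infinite, so the link
    can be enlarged, and the union of the increasing sequence of links is contracted. *)

(* Bases and connectivities may be infinite, so a connectivity cannot be written as a difference of
   ranks. All estimates therefore use [conn], which subtracts ranks of finite sets only; [del_conn]
   is the bridge back to [del], and finite character is what makes it hold. The contracted set C is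
   kept independent throughout. Then independence of I in M/C means independence of I u C in M, the
   rank of a finite set in M/C is attained with a finite part of C, and the limit of an increasing
   sequence of links is again independent by finite character. Contracting a finite set S lowers
   connectivity by at most 2 r(S). This is why infinite connectivity survives every step of the
   iteration. Once everything outside X u Y is contracted or deleted, X is the only separation left,
   so the minor needs a single connectivity, whereas M needs the minimum over all U. *)
Require Import Defs.
From mathcomp Require Import all_boot finmap zify.
From mathcomp Require Import boolp classical_sets cardinality.

Set Implicit Arguments.
Unset Strict Implicit.
Unset Printing Implicit Defensive.

Local Open Scope classical_set_scope.

(* Decides inclusions and equalities of Boolean combinations of sets, by
   classical case analysis on the membership of a generic point; inclusions,
   equalities and disjointness hypotheses in the context are used. *)
Ltac set_hyps x :=
  repeat match goal with
  | H : ?A `<=` ?B |- _ => generalize (H x); clear H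
  | H : @eq ?S ?A ?B |- _ =>
      unify S (set ltac:(let U := type of x in exact U));
      generalize (eq_ind A (fun C : set _ => (A : set _) x <-> C x) (iff_refl _) B H); clear H
  end.
Ltac set_ems x :=
  repeat match goal with
  | A : set _ |- _ =>
      lazymatch goal with
      | _ : A x \/ ~ A x |- _ => fail
      | _ => have ? := EM (A x)
      end
  end.
Ltac set_taut x := first [tauto | set_ems x; tauto].
Ltac set_unfold :=
  cbv beta delta [setU setI setD setC set1 mkset set0 setT subset] in *;
  simpl in *.
Ltac set_solve1 :=
  let x := fresh "x" in
  intro x; set_hyps x; set_unfold;
  lazymatch goal with
  | |- context [x = ?e] =>
      case: (EM (x = e)) => ?; [subst x; set_taut e | set_taut x]
  | _ => set_taut x
  end.
Ltac set_solve :=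
  intros;
  lazymatch goal with
  | |- _ = _ => apply/seteqP; split; set_solve1
  | |- _ => set_solve1
  end.


(** * Cardinalities of finite sets *)

Section FiniteSize.
Variable T : Type.
Implicit Types A B : set T.

(** The alias [{classic T}] supplies the choice structure required by finite sets; infinite sets get
    the default value 0. *)
Definition csize A : nat := #|` fset_set (A : set {classic T})|.

Lemma csize_card A n : (A #= `I_n)%card -> csize A = n.
Proof. exact: (@card_fset_set {classic T}). Qed.

Lemma card_csize A : finite_set A -> (A #= `I_(csize A))%card.
Proof. by move=> [n An]; rewrite (csize_card An). Qed.

Lemma csize0 : csize set0 = 0.
Proof. by rewrite /csize (@fset_set0 {classic T}) cardfs0. Qed.

Lemma csize1 x : csize [set x] = 1.
Proof. by rewrite /csize (@fset_set1 {classic T}) cardfs1. Qed.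

Lemma le_csize A B : finite_set B -> A `<=` B -> csize A <= csize B.
Proof.
move=> fB AB; apply: fsubset_leq_card.
by rewrite -(@fset_set_sub {classic T}) //; exact: sub_finite_set fB.
Qed.

Lemma csizeUI A B : finite_set A -> finite_set B ->
  csize (A `|` B) + csize (A `&` B) = csize A + csize B.
Proof.
move=> fA fB; rewrite /csize (@fset_setU {classic T}) //.
by rewrite (@fset_setI {classic T}) // cardfsUI.
Qed.

Lemma csizeU A B : finite_set A -> finite_set B -> A `&` B = set0 ->
  csize (A `|` B) = csize A + csize B.
Proof. by move=> fA fB AB; rewrite -csizeUI // AB csize0 addn0. Qed.

Lemma csizeU_le A B : finite_set A -> finite_set B ->
  csize (A `|` B) <= csize A + csize B.
Proof. by move=> fA fB; rewrite -csizeUI // leq_addr. Qed.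

Lemma csizeU1 A x : finite_set A -> ~ A x -> csize (A `|` [set x]) = (csize A).+1.
Proof.
move=> fA Ax; rewrite csizeU // ?csize1 ?addn1 //.
by apply/seteqP; split=> // y [/= Ay yx]; apply: Ax; rewrite -yx.
Qed.

Lemma csizeD A B : finite_set A -> B `<=` A -> csize (A `\` B) + csize B = csize A.
Proof.
move=> fA BA; have fB := sub_finite_set BA fA.
rewrite -csizeU //; [by congr csize; set_solve|exact: finite_setD|by set_solve].
Qed.

Lemma csize_eq A B : finite_set B -> A `<=` B -> csize B <= csize A -> A = B.
Proof.
move=> fB AB le; have := csizeD fB AB.
have := le_csize fB AB => leAB eq.
have D0 : csize (B `\` A) = 0 by lia.
have /card_csize : finite_set (B `\` A) by exact: finite_setD.
rewrite D0 II0 card_eq0 => /eqP DB.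
by set_solve.
Qed.

Lemma finite_subset_of_size A n : ~ finite_set A ->
  exists F, [/\ F `<=` A, finite_set F & csize F = n].
Proof.
move=> infA; elim: n => [|n IH].
  by exists set0; rewrite csize0; split.
have [F [FA fF cF]] := IH.
have [x Ax Fx] : exists2 x, A x & ~ F x.
  apply: contrapT => no; apply: infA.
  apply: sub_finite_set fF => x Ax; apply: contrapT => Fx; apply: no; by exists x.
exists (F `|` [set x]); split; first by move=> y [/FA|->].
- by rewrite finite_setU.
- by rewrite csizeU1 // cF.
Qed.

Lemma finite_set_ind (P : set T -> Prop) : P set0 ->
  (forall A x, finite_set A -> ~ A x -> P A -> P (A `|` [set x])) ->
  forall A, finite_set A -> P A.
Proof.
move=> P0 PS A fA; have [n] := ubnP (csize A).
elim: n A fA => // n IH A fA ltA.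
have [->//|/set0P[x Ax]] := eqVneq A set0.
have eA : A = A `\` [set x] `|` [set x] by set_solve.
rewrite eA; apply: PS; [exact: finite_setD|by case => _; apply|].
apply: IH; first exact: finite_setD.
have := csizeD fA (B := [set x]); rewrite csize1 => /(_ _).
by rewrite sub1set inE => /(_ Ax); lia.
Qed.

End FiniteSize.

(** * Restriction, duality and contraction from the axioms *)

Section MatroidBasics.
Variable T : Type.
Implicit Types (M N : indep_system T) (A B C D I J K S U X : set T).

Lemma indep_system_eq M N : ground M = ground N ->
  (forall I, indep M I <-> indep N I) -> M = N.
Proof.
case: M N => [E F] [E' F'] /= -> h; congr IndepSystem.
by apply/seteqP; split=> I /h.
Qed.

Lemma max_inI (F : set (set T)) A : F A ->
  (forall I J, F J -> I `<=` J -> F I) ->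
  (forall x, ~ A x -> ~ F (A `|` [set x])) -> max_in F A.
Proof.
move=> FA Fsub Fx; split=> // B FB AB; apply/seteqP; split=> // x Bx.
apply: contrapT => /Fx; apply; apply: Fsub FB _ => y [/AB|->] //.
Qed.

Lemma max_in_dep (F : set (set T)) A x : max_in F A -> ~ A x -> ~ F (A `|` [set x]).
Proof.
move=> [_ maxA] Ax /maxA eA; apply: Ax; rewrite -eA; first by right.
by left.
Qed.

Lemma max_restrict_dep M S B x : basis (restrict M S) B -> S x -> ~ B x ->
  ~ indep M (B `|` [set x]).
Proof.
move=> bB Sx Bx iBx; apply: (max_in_dep bB Bx); split=> // y [|->] //.
by case: bB => -[_ h] _; exact: h.
Qed.

Lemma basis_restrictI M S B : is_matroid M -> indep M B -> B `<=` S ->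
  (forall x, S x -> ~ B x -> ~ indep M (B `|` [set x])) -> basis (restrict M S) B.
Proof.
move=> mM iB BS dep; apply: max_inI => //= [I J [iJ JS] IJ|x Bx [ix h]].
  by split; [exact: (indep_subset mM) IJ|exact: subset_trans JS].
by apply: (dep x) => //; apply: h; right.
Qed.

Lemma restrict_extend M S I : is_matroid M -> indep M I -> I `<=` S ->
  exists2 B, basis (restrict M S) B & I `<=` B.
Proof.
move=> mM iI IS; have IG := indep_ground mM iI.
have ISG : I `<=` S `&` ground M by move=> x Ix; split; [exact: IS|exact: IG].
have [J [[iJ IJ JS] maxJ]] := indep_max mM iI ISG (@subIsetr _ _ _).
exists J => //; split=> [|K [iK KS] JK]; first by split=> // x /JS[].
apply: maxJ => //; split=> //; first exact: subset_trans JK.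
by move=> x Kx; split; [exact: KS|exact: indep_ground Kx].
Qed.

(** A maximal independent set between I and I u B is already a basis of M: otherwise (I3) would add
    to it an element of B. *)
Lemma basis_extend M I B : is_matroid M -> indep M I -> basis M B ->
  exists J, [/\ basis M J, I `<=` J & J `<=` I `|` B].
Proof.
move=> mM iI bB; have [J bJ IJ] := restrict_extend mM iI (@subsetUl _ I B).
exists J; split=> //; last by case: bJ => -[].
have [iJ JS] := proj1 bJ.
apply: contrapT => nJ; have [x [Bx Jx]] := indep_augment mM iJ nJ bB.
by apply: max_restrict_dep bJ _ Jx; right.
Qed.

Lemma basis_ex M I : is_matroid M -> indep M I -> exists2 B, basis M B & I `<=` B.
Proof.
move=> mM iI; have [B [[iB _] maxB] IB] := restrict_extend mM iI (indep_ground mM iI).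
exists B => //; split=> // J iJ BJ; apply: maxB => //.
by split=> //; exact: (indep_ground mM).
Qed.

Lemma basis_exchange M A B z : is_matroid M -> basis M A -> basis M B ->
  A z -> ~ B z -> exists x, [/\ B x, ~ A x & indep M (A `\` [set z] `|` [set x])].
Proof.
move=> mM bA bB Az Bz.
have iA : indep M (A `\` [set z]) by apply: (indep_subset mM (proj1 bA)) => y [].
have [|x [Bx Ax] ix] := indep_augment mM iA _ bB.
  move=> [_ maxA]; suff : (A `\` [set z]) z by case=> _; apply.
  have <- : A = A `\` [set z] by apply: maxA (proj1 bA) _ => y [].
  by [].
exists x; split=> // Ax'; apply: Ax; split=> // xz; apply: Bz; by rewrite -xz.
Qed.

(** Only (I3) is delicate: I' is maximal in S but not in M, so both I and I' are first extended to
    bases of M, in such a way that the basis above I gains only elements of a basis B with B n S =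
    I'. *)
Lemma restrict_matroid M S : is_matroid M -> S `<=` ground M -> is_matroid (restrict M S).
Proof.
move=> mM SG; split=> /=.
- by move=> I [].
- by split=> //; exact: indep_set0 mM.
- by move=> I J [iJ JS] IJ; split; [exact: indep_subset IJ|exact: subset_trans JS].
- move=> I I' [iI IS] nI bI'; have [[iI' I'S] _] := bI'.
  have [y [Sy Iy iy]] : exists y, [/\ S y, ~ I y & indep M (I `|` [set y])].
    apply: contrapT => no; apply: nI; apply: basis_restrictI => // x Sx Ix ix.
    by apply: no; exists x.
  have [B bB I'B] := basis_ex mM iI'.
  have BS : forall x, B x -> S x -> I' x.
    move=> x Bx Sx; apply: contrapT => I'x; apply: (max_restrict_dep bI' Sx I'x).
    by apply: (indep_subset mM (proj1 bB)) => z [/I'B|->].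
  have [J [bJ IJ JIB]] := basis_extend mM iI bB.
  have [[x [Jx Sx Ix]]|no] := EM (exists x, [/\ J x, S x & ~ I x]).
    exists x; first by split=> //; case: (JIB _ Jx) => // Bx; exact: BS.
    split; last by move=> z [/IS|->].
    by apply: (indep_subset mM (proj1 bJ)) => z [/IJ|->].
  (* Now J meets S in I only. Inserting y drives out some z of B outside S; exchanging z in B
     against J' brings in an element x of S, and I' + x becomes independent, against the maximality
     of I' in S. *)
  have [J' [bJ' yJ' J'J]] := basis_extend mM iy bJ.
  have Jy : ~ J y by move=> Jy; apply: no; exists y.
  have [z Jz J'z] : exists2 z, J z & ~ J' z.
    apply: contrapT => noz; have JJ' : J `<=` J'.
      by move=> z Jz; apply: contrapT => J'z; apply: noz; exists z.
    by apply: Jy; rewrite -(proj2 bJ _ (proj1 bJ') JJ'); apply: yJ'; right.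
  have Iz : ~ I z by move=> Iz; apply: J'z; apply: yJ'; left.
  have Bz : B z by case: (JIB _ Jz).
  have Sz : ~ S z by move=> Sz; apply: no; exists z.
  have [x [J'x Bx ix]] := basis_exchange mM bB bJ' Bz J'z.
  exfalso; have Sx : S x.
    case: (J'J _ J'x) => [[/IS//|->//]|Jx].
    by case: (JIB _ Jx) => // /IS.
  apply: (max_restrict_dep bI' Sx) => [/I'B //|].
  apply: (indep_subset mM ix) => w [I'w|->]; last by right.
  left; split; first exact: I'B.
  by move=> wz; apply: Sz; rewrite -wz; exact: I'S.
- move=> I X [iI IS] IX XS.
  have [J bJ IJ] := restrict_extend mM iI IX.
  have [[iJ JX] maxJ] := bJ.
  exists J; split=> [|K [[iK KS] IK KX] JK].
    by split=> //; split=> //; exact: subset_trans XS.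
  by apply: maxJ.
Qed.

Lemma dual_matroid M : is_matroid M -> is_matroid (dual M).
Proof.
move=> mM; split=> /=.
- by move=> I [B bB IB] x /IB[].
- by have [B bB _] := basis_ex mM (indep_set0 mM); exists B.
- by move=> I J [B bB JB] IJ; exists B => //; exact: subset_trans JB.
- move=> I I' [B1 bB1 IB1] nI /(proj1 (basis_dual _ mM))[I'G].
  set B2 := ground M `\` I' => bB2.
  have i2 : indep M (B2 `\` I) by apply: (indep_subset mM (proj1 bB2)) => x [].
  (* J avoids I, so any point outside J, I and B2 can be added to I. If there is none, I is the
     complement of J, hence a dual basis. *)
  have [J [bJ JB2 JB]] := basis_extend mM i2 bB1.
  have [[x [Gx Jx Ix B2x]]|no] :=
    EM (exists x, [/\ ground M x, ~ J x, ~ I x & ~ B2 x]).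
    exists x; first by split=> //; apply: contrapT => I'x; apply: B2x.
    exists J => // y [Iy|->//]; have [Gy B1y] := IB1 _ Iy; split=> // Jy.
    by case: (JB _ Jy) => // -[].
  exfalso; apply: nI; suff -> : I = ground M `\` J.
    apply/(basis_dual _ mM); split; first by move=> x [].
    by rewrite setDD setIidr //; apply: (indep_ground mM); case: bJ.
  apply/seteqP; split=> x.
    move=> Ix; have [Gx B1x] := IB1 _ Ix; split=> // Jx.
    by case: (JB _ Jx) => // -[].
  move=> [Gx Jx]; apply: contrapT => Ix.
  by apply: no; exists x; split=> // B2x; apply: Jx; apply: JB2.
- move=> I X [B1 bB1 IB1] IX XG.
  (* Extending a basis K of the complement of X makes J as small as possible inside X, so that X - J
     is as large as possible. A larger set L would allow an exchange adding to K a point outside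
     X. *)
  have [K bK] := basis_restrict_ex mM (@subDsetl _ (ground M) X).
  have [[iK KX] _] := bK.
  have [J [bJ KJ JB]] := basis_extend mM iK bB1.
  exists (X `\` J); split.
    split; [by exists J => // x [/XG]| |by move=> x []].
    move=> x Ix; split; first exact: IX.
    move=> Jx; case: (JB _ Jx) => [/KX[_]|]; first by apply; exact: IX.
    by case: (IB1 _ Ix).
  move=> L [[B3 bB3 LB3] IL LX] XJL; apply/seteqP; split=> // y Ly; split; first exact: LX.
  move=> Jy; have [Gy B3y] := LB3 _ Ly.
  have [x [B3x Jx ix]] := basis_exchange mM bJ bB3 Jy B3y.
  have Gx : ground M x by apply: (indep_ground mM) B3x; case: bB3.
  have Xx : ~ X x by move=> Xx; case: (LB3 x) => //; apply: XJL.
  apply: (max_restrict_dep bK _ (x := x)) => //; first by move/KJ.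
  apply: (indep_subset mM ix) => w [Kw|->]; last by right.
  left; split; first exact: KJ.
  by move=> wy; have [_] := KX _ Kw; rewrite wy; apply; exact: LX.
Qed.

Lemma dual_dual M : is_matroid M -> dual (dual M) = M.
Proof.
move=> mM; apply: indep_system_eq => //= I; split.
  move=> [B /(basis_dual _ mM)[BG bB] IB].
  by apply: (indep_subset mM (proj1 bB)).
move=> iI; have [B bB IB] := basis_ex mM iI.
have BG := indep_ground mM (proj1 bB).
exists (ground M `\` B); last by rewrite setDD setIidr.
by apply/(basis_dual _ mM); rewrite setDD setIidr //; split=> // x [].
Qed.

Lemma delete_matroid M X : is_matroid M -> is_matroid (delete M X).
Proof. by move=> mM; apply: restrict_matroid => // x []. Qed.

Lemma contract_matroid M X : is_matroid M -> is_matroid (contract M X).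
Proof. by move=> mM; do 2![apply: dual_matroid || apply: delete_matroid]; exact: dual_matroid. Qed.

(** As C is independent, the maximal dual-independent sets avoiding C are exactly the complements of
    the bases of M that contain C. *)
Lemma contract_indepP M C I : is_matroid M -> indep M C ->
  indep (contract M C) I <-> I `&` C = set0 /\ indep M (I `|` C).
Proof.
move=> mM iC; split.
  move=> [B1 [[[B2 bB2 B12] B1C] maxB1] IB1].
  have [J [bJ CJ JCB]] := basis_extend mM iC bB2.
  have eB1 : ground M `\` J = B1.
    apply: maxB1; first split=> /=.
    - by exists J.
    - by move=> x [Gx Jx]; split=> // /CJ.
    - move=> x B1x; have [Gx B2x] := B12 _ B1x; split=> // Jx.
      by case: (JCB _ Jx) => // Cx; case: (B1C _ B1x).
  split; first by apply/seteqP; split=> // x [/IB1[[]]].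
  apply: (indep_subset mM (proj1 bJ)) => x [/IB1[[Gx Cx] B1x]|/CJ//].
  by apply: contrapT => Jx; apply: B1x; rewrite -eB1.
move=> [IC0 iIC]; have [J bJ ICJ] := basis_ex mM iIC.
exists (ground M `\` J).
  split=> [|K [[B2 bB2 KB2] KC] JK].
    split; first by exists J.
    by move=> x [Gx Jx]; split=> // Cx; apply: Jx; apply: ICJ; right.
  have B2J : B2 `<=` J.
    move=> x B2x; apply: contrapT => Jx.
    have Gx := indep_ground mM (proj1 bB2) B2x.
    by case: (KB2 x) => //; apply: JK.
  have e := proj2 bB2 _ (proj1 bJ) B2J.
  by apply/seteqP; split=> // x /KB2; rewrite e.
have IG := indep_ground mM iIC.
move=> x Ix; split; last by case=> _; apply; apply: ICJ; left.
split; first by apply: IG; left.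
by move=> Cx; have : (I `&` C) x by []; rewrite IC0.
Qed.

End MatroidBasics.

(** * Finite character and comparison of bases with finite difference *)

Section FiniteCharacter.
Variable T : Type.
Implicit Types (M N : indep_system T) (A B C D I J K S U X : set T).

(** Finitarity phrased without circuits: in this form it passes directly to the minors used below,
    see [minor_finite_character]. *)
Definition finite_character M := forall S, S `<=` ground M ->
  (forall F, F `<=` S -> finite_set F -> indep M F) -> indep M S.

(* For B a basis of M|S and x in S outside B, the fundamental circuit of x is the
   set of the z for which B + x - z is independent. *)
Lemma dependent_circuit M S : is_matroid M -> S `<=` ground M -> ~ indep M S ->
  exists2 C, circuit M C & C `<=` S.
Proof.
move=> mM SG nS.
have [B bB] := basis_restrict_ex mM SG.
have [[iB BS] _] := bB.
have [x Sx Bx] : exists2 x, S x & ~ B x.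
  apply: contrapT => no; apply: nS; apply: (indep_subset mM iB) => x Sx.
  by apply: contrapT => Bx; apply: no; exists x.
set X := B `|` [set x].
have XS : X `<=` S by move=> y [/BS|->].
have XG := subset_trans XS SG.
have nX : ~ indep M X := max_restrict_dep bB Sx Bx.
have bBX : basis (restrict M X) B.
  apply: basis_restrictI => // [y|y Xy By]; first by left.
  exact: max_restrict_dep bB (XS _ Xy) By.
pose C := [set z | X z /\ indep M (X `\` [set z])].
have CX : C `<=` X by move=> z [].
have Cmin D : D `<=` X -> ~ indep M D -> C `<=` D.
  move=> DX nD z [Xz iz]; apply: contrapT => Dz; apply: nD.
  by apply: (indep_subset mM iz) => y Dy; split; [exact: DX|move=> yz; apply: Dz; rewrite -yz].
exists C; last exact: subset_trans XS.
split=> [|D [DG nD] DC]; last first.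
  by apply/seteqP; split=> //; apply: Cmin => //; exact: subset_trans CX.
split; first exact: subset_trans XG.
(* If C were independent, it would lie in a basis B2 of X missing some z. Exchanging z in B can only
   bring in x, so X - z is independent and z belongs to C, hence to B2. *)
move=> iC; have mX := restrict_matroid mM XG.
have [B2 bB2 CB2] := restrict_extend mM iC CX.
have [[iB2 B2X] _] := bB2.
have [z Xz B2z] : exists2 z, X z & ~ B2 z.
  apply: contrapT => no; apply: nX; apply: (indep_subset mM iB2) => z Xz.
  by apply: contrapT => B2z; apply: no; exists z.
have Cx : C x.
  split; first by right.
  by apply: (indep_subset mM iB) => y [[]].
have Bz : B z by case: Xz => // zx; case: B2z; rewrite zx; exact: CB2.
have [y [B2y By [iy _]]] := basis_exchange mX bBX bB2 Bz B2z.
have yx : y = x by case: (B2X _ B2y).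
apply: B2z; apply: CB2; split=> //.
apply: (indep_subset mM iy) => w [[Bw|->] wz]; first by left.
by right.
Qed.

Lemma finitary_finite_character M : is_matroid M -> finitary M -> finite_character M.
Proof.
move=> mM fM S SG iF; apply: contrapT => nS.
have [C cC CS] := dependent_circuit mM SG nS.
by case: (cC) => -[_ nC] _; apply: nC; apply: iF => //; exact: fM.
Qed.

Lemma finite_character_dep M S : is_matroid M -> finite_character M ->
  S `<=` ground M -> ~ indep M S ->
  exists F, [/\ F `<=` S, finite_set F & ~ indep M F].
Proof.
move=> mM fM SG nS; apply: contrapT => no; apply: nS; apply: fM => // F FS fF.
by apply: contrapT => nF; apply: no; exists F.
Qed.

(** Exchanging some x of B1 - B2 for some y of B2 - B1 removes one element from each difference;
    induction on the finite one. *)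
Lemma basis_diff_le M B1 B2 : is_matroid M -> basis M B1 -> basis M B2 ->
  finite_set (B1 `\` B2) ->
  finite_set (B2 `\` B1) /\ csize (B2 `\` B1) <= csize (B1 `\` B2).
Proof.
move=> mM + bB2; have [n] := ubnP (csize (B1 `\` B2)).
elim: n B1 => // n IH B1 ltn bB1 fB1.
have [B12|] := EM (B1 `<=` B2).
  by rewrite (proj2 bB1 _ (proj1 bB2) B12) setDv csize0.
move/existsNP => [x /not_implyP[B1x B2x]].
have [y [B2y B1y iy]] := basis_exchange mM bB1 bB2 B1x B2x.
set B3 := _ `|` _ in iy.
have bB3 : basis M B3.
  (* If B3 were not maximal, (I3) against B1 could only put x back, and B1 + y would be
     independent. *)
  apply: contrapT => nB3; have [z [B1z B3z] iz] := indep_augment mM iy nB3 bB1.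
  have zx : z = x by apply: contrapT => zx; apply: B3z; left.
  apply: (max_in_dep bB1 B1y); apply: (indep_subset mM iz) => w [B1w|->].
    have [->|wx] := EM (w = x); first by right; rewrite zx.
    by left; left.
  by left; right.
have B31 : (B3 `\` B2) `|` [set x] `<=` B1 `\` B2.
  by move=> w [[[[B1w wx]|->]] // B2w|->].
have fB3 : finite_set (B3 `\` B2).
  by apply: sub_finite_set fB1 => w B3w; apply: B31; left.
have : csize ((B3 `\` B2) `|` [set x]) <= csize (B1 `\` B2) by exact: le_csize.
rewrite csizeU1 //; last first.
  by move=> [[[_ /(_ erefl)//]|xy] _]; apply: B2x; rewrite xy.
move=> lt; have [|f23 le23] := IH B3 _ bB3 fB3; first by lia.
have B21 : B2 `\` B1 `<=` (B2 `\` B3) `|` [set y].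
  move=> w [B2w B1w]; have [->|wy] := EM (w = y); first by right.
  by left; split=> // -[[]|].
have f21 : finite_set ((B2 `\` B3) `|` [set y]) by rewrite finite_setU; split.
split; first exact: sub_finite_set B21 f21.
have := le_csize f21 B21; have := csizeU_le f23 (finite_set1 y).
by rewrite csize1; lia.
Qed.

(** Otherwise I is a basis of M|(I u J), and [basis_diff_le] makes it at least as large as a basis
    containing J. *)
Lemma indep_augment_finite M I J : is_matroid M -> indep M I -> indep M J ->
  finite_set I -> finite_set J -> csize I < csize J ->
  exists x, [/\ J x, ~ I x & indep M (I `|` [set x])].
Proof.
move=> mM iI iJ fI fJ lt; apply: contrapT => no.
have SG : I `|` J `<=` ground M.
  by move=> x [/(indep_ground mM iI)|/(indep_ground mM iJ)].
have mS := restrict_matroid mM SG.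
have bI : basis (restrict M (I `|` J)) I.
  apply: basis_restrictI => // x Sx Ix ix.
  by apply: no; exists x; split=> //; case: Sx.
have [B bB JB] := restrict_extend mM iJ (@subsetUr _ I J).
have fB : finite_set B.
  by apply: (@sub_finite_set _ _ (I `|` J)); [case: bB => -[]|rewrite finite_setU].
have fIB : finite_set (I `\` B) by exact: finite_setD.
have fBI : finite_set (B `&` I) by apply: sub_finite_set fB => x [].
have [fD leD] := basis_diff_le mS bI bB fIB.
have := le_csize fB JB; have := csizeU_le fBI fD; rewrite setUIDK.
have := csizeD fI (@subIsetr _ B I); rewrite setDIr setDv setU0.
lia.
Qed.

End FiniteCharacter.

(** * Ranks of finite sets *)

Section Rank.
Variables (T : Type) (M : indep_system T).
Hypothesis mM : is_matroid M.
Implicit Types (A B C D I J K S U X : set T).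

(* Meaningful for finite A only; A need not be included in the ground set. *)
Definition rk A : nat :=
  xget 0 [set n | exists2 K, basis (restrict M A) K & n = csize K].

Lemma rk_basis A : exists2 K, basis (restrict M A) K & rk A = csize K.
Proof.
have [K bK _] := restrict_extend mM (indep_set0 mM) (@sub0set _ A).
rewrite /rk; case: xgetP => [_ -> [K' bK' ->]|/(_ (csize K)) []]; first by exists K'.
by exists K.
Qed.

Lemma rk_ge A K : finite_set A -> indep M K -> K `<=` A -> csize K <= rk A.
Proof.
move=> fA iK KA; have [B bB ->] := rk_basis A.
have [[iB BA] _] := bB.
rewrite leqNgt; apply/negP => lt.
have [x [Kx Bx ix]] := indep_augment_finite mM iB iK
  (sub_finite_set BA fA) (sub_finite_set KA fA) lt.
by apply: max_restrict_dep bB (KA _ Kx) Bx ix.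
Qed.

Lemma rk_extend A I : finite_set A -> indep M I -> I `<=` A ->
  exists K, [/\ indep M K, I `<=` K, K `<=` A & rk A = csize K].
Proof.
move=> fA iI IA; have [K bK IK] := restrict_extend mM iI IA.
have [[iK KA] _] := bK; exists K; split=> //.
apply/eqP; rewrite eqn_leq rk_ge // andbT.
have [B [[iB BA] _] ->] := rk_basis A.
rewrite leqNgt; apply/negP => lt.
have [x [Bx Kx ix]] := indep_augment_finite mM iK iB
  (sub_finite_set KA fA) (sub_finite_set BA fA) lt.
by apply: max_restrict_dep bK (BA _ Bx) Kx ix.
Qed.

Lemma rk_max A K : finite_set A -> indep M K -> K `<=` A ->
  (forall x, A x -> ~ K x -> ~ indep M (K `|` [set x])) -> rk A = csize K.
Proof.
move=> fA iK KA dep; have [L [iL KL LA ->]] := rk_extend fA iK KA.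
congr csize; apply/seteqP; split=> // x Lx; apply: contrapT => Kx.
by apply: (dep x (LA _ Lx) Kx); apply: (indep_subset mM iL) => y [/KL|->].
Qed.

Lemma rk_le_csize A : finite_set A -> rk A <= csize A.
Proof. by move=> fA; have [K [[_ KA] _] ->] := rk_basis A; exact: le_csize. Qed.

Lemma rk_indep A : finite_set A -> indep M A -> rk A = csize A.
Proof. by move=> fA iA; apply/eqP; rewrite eqn_leq rk_le_csize // rk_ge. Qed.

Lemma indep_rk A : finite_set A -> csize A <= rk A -> indep M A.
Proof.
move=> fA; have [K [[iK KA] _] -> le] := rk_basis A.
by rewrite -(csize_eq fA KA le).
Qed.

Lemma le_rk A B : finite_set B -> A `<=` B -> rk A <= rk B.
Proof.
move=> fB AB; have [K [[iK KA] _] ->] := rk_basis A.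
by apply: rk_ge => //; exact: subset_trans AB.
Qed.

Lemma rk_submod A B : finite_set A -> finite_set B ->
  rk (A `|` B) + rk (A `&` B) <= rk A + rk B.
Proof.
move=> fA fB; have fAB : finite_set (A `|` B) by rewrite finite_setU.
have [K [[iK KAB] _] ->] := rk_basis (A `&` B).
have KU : K `<=` A `|` B by move=> x /KAB[]; left.
have [L [iL KL LAB ->]] := rk_extend fAB iK KU.
have iLA : indep M (L `&` A) by apply: (indep_subset mM iL) => x [].
have iLB : indep M (L `&` B) by apply: (indep_subset mM iL) => x [].
have fL := sub_finite_set LAB fAB.
have fLA := sub_finite_set (@subIsetl _ L A) fL.
have fLB := sub_finite_set (@subIsetl _ L B) fL.
have := rk_ge fA iLA (@subIsetr _ _ _); have := rk_ge fB iLB (@subIsetr _ _ _).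
have := csizeUI fLA fLB; rewrite -setIUr setIidl //.
have : csize K <= csize (L `&` A `&` (L `&` B)).
  apply: le_csize; first exact: (sub_finite_set (@subIsetl _ _ _) fLA).
  by move=> x Kx; have [] := KAB _ Kx; have := KL _ Kx.
lia.
Qed.

Lemma rk0 : rk set0 = 0.
Proof. by rewrite rk_indep ?csize0 //; exact: indep_set0 mM. Qed.

Lemma rkU1 A x : finite_set A -> rk (A `|` [set x]) <= (rk A).+1.
Proof.
move=> fA; have := rk_submod fA (finite_set1 x).
by have := rk_le_csize (finite_set1 x); rewrite csize1; lia.
Qed.

(** Extend a basis I of A to a basis L of A u B and take K = L - I: a further element of A in L
    would exceed r(A). *)
Lemma rk_basis_over A B : finite_set A -> finite_set B ->
  exists2 K, K `<=` B & rk (A `|` K) = rk (A `|` B) /\ rk (A `|` K) = rk A + csize K.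
Proof.
move=> fA fB; have fAB : finite_set (A `|` B) by rewrite finite_setU.
have [I [[iI IA] _] rI] := rk_basis A.
have [L [iL IL LAB rL]] := rk_extend fAB iI (subset_trans IA (@subsetUl _ A B)).
have fL := sub_finite_set LAB fAB.
have e : L = I `|` (L `\` I) by set_solve.
have s : csize (L `\` I) + csize I = csize L by exact: csizeD.
have LIB : L `\` I `<=` B.
  move=> x [Lx Ix]; case: (LAB _ Lx) => // Ax; exfalso.
  have : csize (I `|` [set x]) <= rk A.
    by apply: rk_ge => // [|y [/IA|->]] //; apply: (indep_subset mM iL) => y [/IL|->].
  by rewrite csizeU1 ?rI ?ltnn //; exact: sub_finite_set IA fA.
exists (L `\` I) => //.
have r1 : csize L <= rk (A `|` (L `\` I)).
  apply: rk_ge => //; last by set_solve.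
  by rewrite finite_setU; split=> //; exact: finite_setD.
have r2 : rk (A `|` (L `\` I)) <= rk (A `|` B).
  by apply: le_rk => //; set_solve.
by split; lia.
Qed.

End Rank.

(* [r set0] may be nonzero, so that contracting S is replacing r by r(_ u S), without
   subtracting the constant r(S). *)
Record rank_fun (T : Type) (r : set T -> nat) : Prop := RankFun {
  rank_mono : forall A B, finite_set B -> A `<=` B -> r A <= r B;
  rank_submod : forall A B, finite_set A -> finite_set B ->
    r (A `|` B) + r (A `&` B) <= r A + r B;
  rank_unit : forall A x, finite_set A -> r (A `|` [set x]) <= (r A).+1
}.

(** * Tutte's linking theorem for finite rank functions *)

Section Linking.
Variable T : Type.
Implicit Types (r : set T -> nat) (A B C D I J K S U V W X Y Z E : set T).

Lemma rk_rank_fun (M : indep_system T) : is_matroid M -> rank_fun (rk M).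
Proof.
by move=> mM; split=> *; [exact: le_rk|exact: rk_submod|exact: rkU1].
Qed.

Lemma rank_fun_contract r S : rank_fun r -> finite_set S ->
  rank_fun (fun A => r (A `|` S)).
Proof.
move=> hr fS; split.
- by move=> A B fB AB; apply: (rank_mono hr); [rewrite finite_setU|exact: setSU].
- move=> A B fA fB; have := rank_submod hr (A := A `|` S) (B := B `|` S).
  rewrite !finite_setU => /(_ (conj fA fS) (conj fB fS)).
  by rewrite -setUUl setUIl.
- by move=> A x fA; rewrite setUAC; apply: (rank_unit hr); rewrite finite_setU.
Qed.

(** Each e in W is deleted or contracted. The induction on W is for all [r] at once, because
    contracting e replaces [r] by [r']. *)
Lemma finite_linking k W r X Y : finite_set W -> rank_fun r ->
  finite_set X -> finite_set Y ->
  X `&` Y = set0 -> W `&` (X `|` Y) = set0 ->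
  (forall U, X `<=` U -> U `<=` X `|` W ->
    k + r (X `|` Y `|` W) + r set0 <= r U + r ((X `|` Y `|` W) `\` U)) ->
  exists2 C, C `<=` W & k + r (X `|` Y `|` C) + r C <= r (X `|` C) + r (Y `|` C).
Proof.
move=> fW + fX fY XY0; elim/finite_set_ind: W / fW r => [r hr _ sep|W e fW We IH r hr disj sep].
  exists set0 => //; have := sep X (fun x h => h) (@subsetUl _ X _).
  rewrite !setU0 setDUl setDv set0U.
  suff -> : Y `\` X = Y by [].
  by clear -XY0; set_solve.
have XYe : ~ (X `|` Y) e.
  move=> h; have : ((W `|` [set e]) `&` (X `|` Y)) e by split=> //; right.
  by rewrite disj.
have disjW : W `&` (X `|` Y) = set0 by clear -disj; set_solve.
set Z := X `|` Y `|` W.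
have fZ : finite_set Z by rewrite !finite_setU.
have fZe : finite_set (Z `|` [set e]) by rewrite finite_setU; split.
have [sepD|] := EM (forall U, X `<=` U -> U `<=` X `|` W ->
    k + r Z + r set0 <= r U + r (Z `\` U)).
  by have [C CW h] := IH r hr disjW sepD; exists C => // x /CW; left.
move=> /existsNP[U1 /not_implyP[XU1 /not_implyP[U1W lt1]]].
pose r' A := r (A `|` [set e]).
have hr' : rank_fun r' by exact: rank_fun_contract.
have [sepC|] := EM (forall U, X `<=` U -> U `<=` X `|` W ->
    k + r' Z + r' set0 <= r' U + r' (Z `\` U)).
  have [C CW h] := IH r' hr' disjW sepC; exists (C `|` [set e]).
    by move=> x [/CW|->]; [left|right].
  by rewrite !setUA.
move=> /existsNP[U2 /not_implyP[XU2 /not_implyP[U2W lt2]]].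
(* U1 is too small a separation after deleting e, U2 after contracting it. Uncrossing U1 with U2 +
   e, and likewise their complements, gives the separations U1 n U2 and U1 u U2 + e of the whole
   set. The two strict inequalities leave a gap of 2, of which the unit increase from r(set0) to
   r(e) explains only 1. *)
exfalso.
have U1Z : U1 `<=` Z by rewrite /Z; clear -U1W; set_solve.
have U2Z : U2 `<=` Z by rewrite /Z; clear -U2W; set_solve.
have fU1 := sub_finite_set U1Z fZ.
have fU2 : finite_set (U2 `|` [set e]).
  by rewrite finite_setU; split=> //; exact: sub_finite_set U2Z fZ.
have fV1 : finite_set (Z `\` U1) by exact: finite_setD.
have fV2 : finite_set (Z `\` U2 `|` [set e]).
  by rewrite finite_setU; split=> //; exact: finite_setD.
have := rank_submod hr fU1 fU2; have := rank_submod hr fV1 fV2.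
have Ze : ~ Z e by move=> [/XYe|/We].
have U1e : ~ U1 e by move/U1Z.
have U2e : ~ U2 e by move/U2Z.
have -> : U1 `&` (U2 `|` [set e]) = U1 `&` U2 by clear -U1e; set_solve.
have -> : (Z `\` U1) `&` (Z `\` U2 `|` [set e]) = Z `\` (U1 `|` U2).
  by clear -Ze; set_solve.
have := sep (U1 `&` U2); have := sep (U1 `|` (U2 `|` [set e])).
have -> : X `|` Y `|` (W `|` [set e]) = Z `|` [set e] by rewrite setUA.
have -> : (Z `|` [set e]) `\` (U1 `|` (U2 `|` [set e])) = Z `\` (U1 `|` U2).
  by clear -Ze; set_solve.
have -> : (Z `|` [set e]) `\` (U1 `&` U2) = (Z `\` U1) `|` (Z `\` U2 `|` [set e]).
  by clear -Ze U1e; set_solve.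
have a1 : X `<=` U1 `|` (U2 `|` [set e]) by clear -XU1; set_solve.
have a2 : U1 `|` (U2 `|` [set e]) `<=` X `|` (W `|` [set e]).
  by clear -U1W U2W; set_solve.
have a3 : X `<=` U1 `&` U2 by clear -XU1 XU2; set_solve.
have a4 : U1 `&` U2 `<=` X `|` (W `|` [set e]) by clear -U1W; set_solve.
move=> /(_ a1 a2) h1 /(_ a3 a4) h2 h3 h4.
have h5 : r Z <= r (Z `|` [set e]) by apply: (rank_mono hr) => // x; left.
have h6 := rank_unit hr e (finite_set0 T).
rewrite /r' in lt2; lia.
Qed.

End Linking.

(** * Compactness: from finite to arbitrary ground sets *)

Section Compactness.
Variable T : Type.
Implicit Types (r : set T -> nat) (A B C D I J K S U V W X Y Z E : set T).

Lemma chain_finite (P : Type) (F : set (set P)) (S : set P) : total_on F subset ->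
  F !=set0 -> finite_set S -> S `<=` \bigcup_(G in F) G ->
  exists2 G, F G & S `<=` G.
Proof.
move=> totF [G0 FG0] fS; elim/finite_set_ind: S / fS => [|S x fS Sx IH] SF.
  by exists G0.
have [|G FG SG] := IH; first by move=> y Sy; apply: SF; left.
have [|H FH Hx] := SF x; first by right.
have [GH|HG] := totF _ _ FG FH.
  by exists H => // y [/SG/GH|->].
by exists G => // y [/SG|->] //; exact: HG.
Qed.

(** Enlarge A first and B afterwards; each enlargement costs one use of submodularity. *)
Lemma conn_mono r k A A' B B' : rank_fun r -> finite_set A' -> finite_set B' ->
  A `<=` A' -> B `<=` B' -> k + r (A `|` B) <= r A + r B ->
  k + r (A' `|` B') <= r A' + r B'.
Proof.
move=> hr fA' fB' AA' BB' h.
have fA := sub_finite_set AA' fA'; have fB := sub_finite_set BB' fB'.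
have fAB : finite_set (A `|` B) by rewrite finite_setU.
have fA'B : finite_set (A' `|` B) by rewrite finite_setU.
have := rank_submod hr fA' fAB.
have -> : A' `|` (A `|` B) = A' `|` B by clear -AA'; set_solve.
have : r A <= r (A' `&` (A `|` B)).
  apply: (rank_mono hr); first by apply: sub_finite_set fA' => x [].
  by clear -AA'; set_solve.
have := rank_submod hr fB' fA'B.
have -> : B' `|` (A' `|` B) = A' `|` B' by clear -BB'; set_solve.
have : r B <= r (B' `&` (A' `|` B)).
  apply: (rank_mono hr); first by apply: sub_finite_set fB' => x [].
  by clear -BB'; set_solve.
lia.
Qed.

(* A set G of pairs imposes side conditions on a separation U, namely that x is in U
   if G (true, x), and outside U if G (false, x). If no finite Z worked, a maximal set
   of conditions for which no finite Z works would decide all of E. *)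
Lemma compact_separations r k E X Y : rank_fun r -> X `&` Y = set0 ->
  X `<=` E -> Y `<=` E ->
  (forall U, X `<=` U -> U `<=` E `\` Y -> exists A B,
     [/\ finite_set A, finite_set B, A `<=` U, B `<=` E `\` U
       & k + r (A `|` B) <= r A + r B]) ->
  exists Z, [/\ finite_set Z, Z `<=` E &
    forall U, X `&` Z `<=` U -> U `&` Z `&` Y = set0 ->
      k + r Z <= r (U `&` Z) + r (Z `\` U)].
Proof.
move=> hr XY0 XE YE sep.
pose UG (G : set (bool * T)) := X `|` [set x | G (true, x)].
pose VG (G : set (bool * T)) := Y `|` [set x | G (false, x)].
pose good G := exists Z, [/\ finite_set Z, Z `<=` E &
    forall U, UG G `&` Z `<=` U -> U `&` Z `&` VG G = set0 ->
      k + r Z <= r (U `&` Z) + r (Z `\` U)].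
have [[Z [fZ ZE hZ]]|bad0] := EM (good set0).
  exists Z; split=> // U XU UY; apply: hZ.
    by move=> x [[|//] Xx Zx]; apply: XU.
  by apply/seteqP; split=> // x [Ux [|//] Yx]; rewrite -UY.
exfalso.
have [|G [badG maxG]] := Zorn_bigcup (P := [set G | ~ good G]).
  move=> F FP totF [Z [fZ ZE hZ]].
  have [[G0 FG0]|F0] := EM (F !=set0); last first.
    apply: bad0; exists Z; split=> // U XU UY; apply: hZ.
      by move=> x [[Xx|[G FG _]] Zx]; [apply: XU; split=> //; left|case: F0; exists G].
    apply/seteqP; split=> // x [Ux [Yx|[G FG _]]]; last by case: F0; exists G.
    by rewrite -UY; split=> //; left.
  (* Only conditions on points of the finite set Z matter, and a single member of the chain contains
     all of them. *)
  pose S := (\bigcup_(G in F) G) `&` (setT `*` Z).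
  have fS : finite_set S.
    by apply: (@sub_finite_set _ _ (setT `*` Z)) => [x []//|]; exact: finite_setX.
  have [G FG SG] := chain_finite totF (ex_intro _ G0 FG0) fS (@subIsetl _ _ _).
  apply: (FP _ FG); exists Z; split=> // U XU UY; apply: hZ.
    move=> x [[Xx|Gx] Zx]; first by apply: XU; split=> //; left.
    by apply: XU; split=> //; right; apply: SG.
  apply/seteqP; split=> // x [[Ux Zx] [Yx|Gx]]; first by rewrite -UY; split=> //; left.
  by rewrite -UY; split=> //; right; apply: SG.
have step b e : ~ G (b, e) -> good (G `|` [set (b, e)]).
  move=> Ge; apply: contrapT; apply: maxG; split; first by move=> x; left.
  by move=> /(_ (b, e)) h; apply: Ge; apply: h; right.
(* If e were undecided, maximality would give a finite set for each of the two extensions of G.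
   Every U satisfies one of the two conditions on e, so the union of these sets would serve for
   G. *)
have total e : E e -> UG G e \/ VG G e.
  move=> Ee; apply: contrapT => /not_orP[Ue Ve].
  have [Z1 [fZ1 Z1E h1]] : good (G `|` [set (true, e)]).
    by apply: step => ?; apply: Ue; right.
  have [Z2 [fZ2 Z2E h2]] : good (G `|` [set (false, e)]).
    by apply: step => ?; apply: Ve; right.
  apply: badG; have fZ : finite_set (Z1 `|` Z2) by rewrite finite_setU.
  exists (Z1 `|` Z2); split=> //; first by move=> x [/Z1E|/Z2E].
  move=> U UU UV.
  have fin1 : finite_set (U `&` (Z1 `|` Z2)).
    exact: (sub_finite_set (@subIsetr _ _ _) fZ).
  have fin2 : finite_set ((Z1 `|` Z2) `\` U) by exact: finite_setD.
  have splitU Z : Z = U `&` Z `|` (Z `\` U) by rewrite setIC setUIDK.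
  rewrite {1}(splitU (Z1 `|` Z2)).
  have [Ue1|Ue1] := EM (U e).
    apply: (conn_mono (A := U `&` Z1) (B := Z1 `\` U)) => //.
    - by apply: setIS => x; left.
    - by apply: setSD => x; left.
    rewrite -splitU; apply: h1.
      move=> x [[Xx|[Gx|[->]]] Zx] //; apply: UU; split=> //; by [left|right|left; left].
    by apply/seteqP; split=> // x [[Ux Zx] [Yx|[Gx|//]]]; rewrite -UV; split=> //;
      by [split=> //; left|left|right].
  apply: (conn_mono (A := U `&` Z2) (B := Z2 `\` U)) => //.
  - by apply: setIS => x; right.
  - by apply: setSD => x; right.
  rewrite -splitU; apply: h2.
    move=> x [[Xx|[Gx|//]] Zx] //; apply: UU; split=> //; by [left|right].
  apply/seteqP; split=> // x [[Ux Zx] [Yx|[Gx|[xe]]]]; last by apply: Ue1; rewrite -xe.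
    by rewrite -UV; split; [split=> //; right|left].
  by rewrite -UV; split; [split=> //; right|right].
(* No U meets contradictory conditions at x, so Z = {x} would serve for G vacuously. *)
have disj x : E x -> UG G x -> VG G x -> False.
  move=> Ex Ux Vx; apply: badG; exists [set x]; split=> // [y ->//|U UU UV].
  have : (U `&` [set x] `&` VG G) x by split=> //; split=> //; apply: UU.
  by rewrite UV.
(* G now determines a separation of E, and the finite witnesses of that separation form a set Z that
   serves for G. *)
have [||A [B [fA fB AU BU h]]] := sep (UG G `&` E).
- by move=> x Xx; split; [left|exact: XE].
- by move=> x [Ux Ex]; split=> // Yx; apply: (disj x) => //; left.
apply: badG; have fZ : finite_set (A `|` B) by rewrite finite_setU.
exists (A `|` B); split=> //; first by move=> x [/AU[]|/BU[]].
move=> U UU UV.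
rewrite {1}(_ : A `|` B = U `&` (A `|` B) `|` ((A `|` B) `\` U)); last by rewrite setIC setUIDK.
apply: conn_mono h => //.
- exact: (sub_finite_set (@subIsetr _ _ _) fZ).
- exact: finite_setD.
- by move=> x Ax; split; [apply: UU; split; [case: (AU _ Ax)|left]|left].
- move=> x Bx; split; [by right|move=> Ux]; have [Ex nUx] := BU _ Bx.
  have Vx : VG G x by case: (total _ Ex) => // ?; case: nUx.
  by have : (U `&` (A `|` B) `&` VG G) x; [split=> //; split=> //; right|rewrite UV].
Qed.

Lemma linking r k E X Y : rank_fun r -> X `&` Y = set0 ->
  X `<=` E -> Y `<=` E ->
  (forall U, X `<=` U -> U `<=` E `\` Y -> exists A B,
     [/\ finite_set A, finite_set B, A `<=` U, B `<=` E `\` U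
       & k + r (A `|` B) + r set0 <= r A + r B]) ->
  exists A B C, [/\ finite_set A, finite_set B & finite_set C] /\
    [/\ A `<=` X, B `<=` Y, C `<=` E `\` (X `|` Y)
      & k + r (A `|` B `|` C) + r C <= r (A `|` C) + r (B `|` C)].
Proof.
move=> hr XY0 XE YE sep.
(* [compact_separations] does not normalise [r], so the term r(set0) is moved into the order. *)
have [|Z [fZ ZE hZ]] := compact_separations (k := k + r set0) hr XY0 XE YE.
  move=> U XU UY; have [A [B [fA fB AU BU h]]] := sep U XU UY.
  by exists A, B; split=> //; lia.
have fXZ : finite_set (X `&` Z) by exact: (sub_finite_set (@subIsetr _ _ _) fZ).
have fYZ : finite_set (Y `&` Z) by exact: (sub_finite_set (@subIsetr _ _ _) fZ).
have fW : finite_set (Z `\` (X `|` Y)) by exact: finite_setD.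
have eZ : X `&` Z `|` Y `&` Z `|` Z `\` (X `|` Y) = Z by clear; set_solve.
have [|||C CW h] := finite_linking (k := k) fW hr fXZ fYZ.
- by clear -XY0; set_solve.
- by clear; set_solve.
- rewrite eZ => U XU UW.
  have UZ : U `&` Z = U by clear -UW; set_solve.
  rewrite -{1}UZ; have := hZ U XU; rewrite addnAC; apply.
  by clear -UW XY0; set_solve.
exists (X `&` Z), (Y `&` Z), C; split; split=> //.
- exact: sub_finite_set CW fW.
- by move=> x /CW[/ZE].
Qed.

End Compactness.

(** * Links and the set to contract *)

Section Links.
Variables (T : Type) (M : indep_system T) (X Y : set T).
Hypotheses (mM : is_matroid M) (XM : X `<=` ground M) (YM : Y `<=` ground M).
Hypothesis XY0 : X `&` Y = set0.
Implicit Types (A B C D I J K S U V W Z E : set T).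

Definition conn (N : indep_system T) k U := exists A B,
  [/\ finite_set A, finite_set B, A `<=` U, B `<=` ground N `\` U
    & k + rk N (A `|` B) <= rk N A + rk N B].

Definition separated k := forall U, X `<=` U -> U `<=` ground M `\` Y -> conn M k U.

(** I u C and J u C are independent with I and J disjoint from C, so [link_rk] says that r(I u C) +
    r(J u C) - r(I u J u C) - r(C) is at least k: I and J have local connectivity at least k in
    M/C. *)
Record link k I J C : Prop := Link {
  link_fin : [/\ finite_set I, finite_set J & finite_set C];
  link_sub : [/\ I `<=` X, J `<=` Y & C `<=` ground M `\` (X `|` Y)];
  link_indep : indep M (I `|` C) /\ indep M (J `|` C);
  link_rk : k + rk M (I `|` J `|` C) <= csize I + csize J + csize C
}.

Lemma link0 : link 0 set0 set0 set0.
Proof.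
split; [by split|by split|by rewrite !setU0; split; exact: indep_set0 mM|].
by rewrite !setU0 rk0 // csize0.
Qed.

Lemma rk_spanU A B D : finite_set B -> finite_set D -> A `<=` B -> rk M A = rk M B ->
  rk M (A `|` D) = rk M (B `|` D).
Proof.
move=> fB fD AB rAB; have fA := sub_finite_set AB fB.
have fAD : finite_set (A `|` D) by rewrite finite_setU.
have fBD : finite_set (B `|` D) by rewrite finite_setU.
have := rk_submod mM fAD fB; have := le_rk mM fBD (setSU AB).
have -> : A `|` D `|` B = B `|` D by clear -AB; set_solve.
have : rk M A <= rk M ((A `|` D) `&` B).
  apply: (le_rk mM); last by clear -AB; set_solve.
  by apply: sub_finite_set fAD => x [].
lia.
Qed.

(** S itself may be dependent: it will be I u J u C for a link, with A one of the independent sets I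
    u C and J u C. *)
Lemma indep_over S A D : finite_set S -> finite_set A -> finite_set D ->
  A `<=` S -> indep M A -> rk M (S `|` D) = rk M S + csize D ->
  indep M (A `|` D) /\ csize (A `|` D) = csize A + csize D.
Proof.
move=> fS fA fD AS iA rD.
have fAD : finite_set (A `|` D) by rewrite finite_setU.
have := rk_submod mM fAD fS.
have -> : A `|` D `|` S = S `|` D by clear -AS; set_solve.
have : csize A <= rk M ((A `|` D) `&` S).
  apply: rk_ge => //; last by clear -AS; set_solve.
  by apply: sub_finite_set fAD => x [].
have le1 := csizeU_le fA fD; have le2 := rk_le_csize mM fAD.
by move=> h1 h2; split; [apply: indep_rk => //; lia|lia].
Qed.

(** Work over S = I u J u C. The connectivity p found after contracting S adds to j, because the old
    link bounds r(S) by |I| + |J| + |C| - j. *)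
Lemma link_step j p I J C : link j I J C ->
  separated (p + 2 * csize (I `|` J `|` C)) ->
  exists I' J' C', [/\ link (j + p) I' J' C', I `<=` I', J `<=` J' & C `<=` C'].
Proof.
move=> [[fI fJ fC] [IX JY CE] [iIC iJC] lk] sep.
set S := I `|` J `|` C in sep lk.
have fS : finite_set S by rewrite !finite_setU.
have rS := rk_le_csize mM fS.
have [|A [B [C1 [[fA fB fC1] [AX BY C1E h]]]]] := linking (k := p)
    (rank_fun_contract (rk_rank_fun mM) fS) XY0 XM YM.
  (* Passing to r(_ u S) loses r(S) on A u B and r(S) from the new value at the empty set: at most 2
     |S| altogether. *)
  move=> U XU UY; have [A [B [fA fB AU BU h]]] := sep U XU UY.
  exists A, B; split=> //; rewrite set0U.
  have fAB : finite_set (A `|` B) by rewrite finite_setU.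
  have := rk_submod mM fAB fS.
  have : rk M A <= rk M (A `|` S) by apply: le_rk => //; rewrite finite_setU.
  have : rk M B <= rk M (B `|` S) by apply: le_rk => //; rewrite finite_setU.
  lia.
(* The sets from [linking] need not be independent. They are thinned, C1 over S and then A and B
   over S u C2, without changing the spans that enter [h]. *)
have [C2 C21 [e1 e2]] := rk_basis_over mM fS fC1.
have fC2 := sub_finite_set C21 fC1.
have fSC : finite_set (S `|` C2) by rewrite finite_setU.
have fSC1 : finite_set (S `|` C1) by rewrite finite_setU.
have SC : S `|` C2 `<=` S `|` C1 by exact: setUS.
have [I2 I2A [e3 e4]] := rk_basis_over mM fSC fA.
have [J2 J2B [e5 e6]] := rk_basis_over mM fSC fB.
have fI2 := sub_finite_set I2A fA; have fJ2 := sub_finite_set J2B fB.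
have e7 := rk_spanU fSC1 fA SC e1; have e8 := rk_spanU fSC1 fB SC e1.
have fCI : finite_set (C2 `|` I2) by rewrite finite_setU.
have fCJ : finite_set (C2 `|` J2) by rewrite finite_setU.
have fIC : finite_set (I `|` C) by rewrite finite_setU.
have fJC : finite_set (J `|` C) by rewrite finite_setU.
have ISC : I `|` C `<=` S by rewrite /S; clear; set_solve.
have JSC : J `|` C `<=` S by rewrite /S; clear; set_solve.
have sI : csize (C2 `|` I2) = csize C2 + csize I2.
  have := csizeU_le fC2 fI2; have := csizeU_le fS fCI; have := rk_submod mM fS fCI.
  rewrite setUA; have := rk_le_csize mM fCI; lia.
have sJ : csize (C2 `|` J2) = csize C2 + csize J2.
  have := csizeU_le fC2 fJ2; have := csizeU_le fS fCJ; have := rk_submod mM fS fCJ.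
  rewrite setUA; have := rk_le_csize mM fCJ; lia.
have [|indI cI] := indep_over fS fIC fCI ISC iIC; first by rewrite setUA; lia.
have [|indJ cJ] := indep_over fS fJC fCJ JSC iJC; first by rewrite setUA; lia.
have eI : I `|` C `|` (C2 `|` I2) = (I `|` I2) `|` (C `|` C2) by clear; set_solve.
have eJ : J `|` C `|` (C2 `|` J2) = (J `|` J2) `|` (C `|` C2) by clear; set_solve.
rewrite eI in indI cI; rewrite eJ in indJ cJ.
exists (I `|` I2), (J `|` J2), (C `|` C2).
split; [|exact: subsetUl|exact: subsetUl|exact: subsetUl].
have fI' : finite_set (I `|` I2) by rewrite finite_setU.
have fJ' : finite_set (J `|` J2) by rewrite finite_setU.
have fC' : finite_set (C `|` C2) by rewrite finite_setU.
split=> //.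
  split; [by move=> x [/IX|/I2A/AX]|by move=> x [/JY|/J2B/BY]|].
  by move=> x [/CE|/C21/C1E].
have IC0 : I `&` C = set0 by clear -IX CE; set_solve.
have JC0 : J `&` C = set0 by clear -JY CE; set_solve.
rewrite (csizeU fI fC IC0) in cI; rewrite (csizeU fJ fC JC0) in cJ.
(* Together with [cI] and [cJ], these upper bounds are forced to be equalities. *)
have c1 := csizeU_le fI' fC'; have c2 := csizeU_le fJ' fC'.
have c3 := csizeU_le fI fI2; have c4 := csizeU_le fJ fJ2; have c5 := csizeU_le fC fC2.
have : rk M (I `|` I2 `|` (J `|` J2) `|` (C `|` C2)) <= rk M (A `|` B `|` C1 `|` S).
  apply: le_rk => //; first by rewrite !finite_setU.
  by rewrite /S; clear -I2A J2B C21; set_solve.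
move: h.
have -> : A `|` C1 `|` S = S `|` C1 `|` A by clear; set_solve.
have -> : B `|` C1 `|` S = S `|` C1 `|` B by clear; set_solve.
rewrite (setUC C1 S) -e7 -e8 -e1.
lia.
Qed.

(* When the connectivity is infinite, C is the union of an increasing sequence of finite
   links; enlarging a link keeps I u C and J u C independent, so every member of the
   sequence remains a link relative to the union. *)
Lemma contraction_set : finite_character M -> exists C,
  [/\ C `<=` ground M `\` (X `|` Y), indep M C &
   forall k, separated k -> exists I J C0,
    [/\ finite_set I, finite_set J & finite_set C0] /\
    [/\ I `<=` X, J `<=` Y & C0 `<=` C] /\
    [/\ indep M (I `|` C), indep M (J `|` C)
      & k + rk M (I `|` J `|` C0) <= csize I + csize J + csize C0]].
Proof.
move=> fcM.
have sep0 : separated 0.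
  move=> U XU UY; exists set0, set0; split=> //.
  by rewrite setU0 rk0.
have sepW k k' : k' <= k -> separated k -> separated k'.
  move=> le sep U XU UY; have [A [B [fA fB AU BU h]]] := sep U XU UY.
  by exists A, B; split=> //; lia.
have [all|/existsNP[n0 nsep]] := EM (forall k, separated k); last first.
  (* Finite connectivity k: one step from the empty link gives order k, which covers every k' with
     [separated k']. *)
  have exn : exists n, `[< ~ separated n >] by exists n0; exact/asboolP.
  case: (ex_minnP exn) => [[|k]] /asboolP nk mink; first by case: nk.
  have sepk : separated k.
    apply: contrapT => /asboolP /mink; by rewrite ltnn.
  have [|I [J [C [[[fI fJ fC] [IX JY CE] [iIC iJC] lk] _ _ _]]]] :=
    link_step (p := k) link0.
    by rewrite !setU0 csize0 muln0 addn0.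
  exists C; split=> //; first by apply: (indep_subset mM iIC); right.
  move=> k' sepk'; exists I, J, C; do 2![split=> //]; split=> //.
  suff : k' <= k by rewrite add0n in lk; lia.
  by rewrite leqNgt; apply/negP => lt; apply: nk; exact: sepW sepk'.
pose st := {s : nat * (set T * set T * set T) | link s.1 s.2.1.1 s.2.1.2 s.2.2}.
have next (s : st) : exists s' : st, [/\ (sval s').1 = (sval s).1.+1,
    (sval s).2.1.1 `<=` (sval s').2.1.1, (sval s).2.1.2 `<=` (sval s').2.1.2 &
    (sval s).2.2 `<=` (sval s').2.2].
  case: s => [[n [[I J] C]] /= lk].
  have [I' [J' [C' [lk' II' JJ' CC']]]] := link_step (p := 1) lk (all _).
  rewrite addn1 in lk'.
  by exists (exist _ (n.+1, (I', J', C')) lk').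
have [f hf] := choice next.
pose s n := iter n f (exist _ (0, (set0, set0, set0)) link0 : st).
pose Is n := (sval (s n)).2.1.1.
pose Js n := (sval (s n)).2.1.2.
pose Cs n := (sval (s n)).2.2.
have ns n : (sval (s n)).1 = n.
  elim: n => // n IH; have [e _ _ _] := hf (s n).
  by rewrite IH in e.
have lks n : link n (Is n) (Js n) (Cs n) by rewrite -{1}(ns n); exact: (svalP (s n)).
have mono n d : [/\ Is n `<=` Is (n + d), Js n `<=` Js (n + d) & Cs n `<=` Cs (n + d)].
  elim: d => [|d [h1 h2 h3]]; first by rewrite addn0; split.
  rewrite addnS; have [_ g1 g2 g3] := hf (s (n + d)).
  split; [exact: subset_trans g1|exact: subset_trans g2|exact: subset_trans g3].
pose C := \bigcup_n Cs n.
have CE : C `<=` ground M `\` (X `|` Y).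
  by move=> x [n _ Cx]; have [_ [_ _ h] _ _] := lks n; exact: h.
have finC F : finite_set F -> F `<=` C -> exists n, F `<=` Cs n.
  move=> fF; elim/finite_set_ind: F / fF => [_|F x fF Fx IH FC]; first by exists 0.
  have [|n Fn] := IH; first by move=> y Fy; apply: FC; left.
  have [|m _ Cx] := FC x; first by right.
  exists (n + m) => y [/Fn|->]; first by have [_ _ h] := mono n m; exact: h.
  by have [_ _ h] := mono m n; rewrite addnC; exact: h.
have indU n : indep M (Is n `|` C) /\ indep M (Js n `|` C).
  have [[fI fJ fC] [IX JY _] _ _] := lks n.
  (* A finite part of K n u C lies in K (n + m) u Cs (n + m) for some m, and finite character does
     the rest. *)
  have main (K : nat -> set T) : (forall m, indep M (K m `|` Cs m)) ->
     (forall d, K n `<=` K (n + d)) -> indep M (K n `|` C).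
    move=> iK Kn; apply: fcM.
      by move=> x [Kx|/CE[]//]; apply: (indep_ground mM (iK n)); left.
    move=> F FK fF.
    have [||m Fm] := finC (F `&` C); [|by move=> x []|].
      by apply: sub_finite_set fF => x [].
    apply: (indep_subset mM (iK (n + m))) => x Fx.
    have [Kx|Cx] := FK _ Fx; first by left; exact: Kn.
    by right; have [_ _ h] := mono m n; rewrite addnC; apply: h; apply: Fm.
  split; apply: main => m; try by case: (mono n m).
    by case: (lks m) => _ _ [].
  by case: (lks m) => _ _ [].
exists C; split=> //; first by apply: (indep_subset mM (proj1 (indU 0))); right.
move=> k _; have [[fI fJ fC] [IX JY _] _ lk] := lks k.
have [iI iJ] := indU k.
exists (Is k), (Js k), (Cs k); do 2![split=> //].
by split=> // x Cx; exists k.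
Qed.

End Links.

(** * Connectivity by finite witnesses, and its invariance under duality *)

Section Kappa.
Variable T : Type.
Implicit Types (M N P : indep_system T) (A B C D F I J K L S U X Y : set T).

(** The order of N u {oo} against finite bounds: [None] is below no n, so these bounds determine a
    value ([ole_eq]) and infinity needs no separate treatment. *)
Definition ole (o : option nat) n := exists2 m, o = Some m & m <= n.

Lemma ole_eq a b : (forall n, ole a n <-> ole b n) -> a = b.
Proof.
case: a b => [m|] [p|] //= h.
- have /h[m' [e1] le1] : ole (Some m) m by exists m.
  have /h[p' [e2] le2] : ole (Some p) p by exists p.
  by congr Some; lia.
- by have /h[]// : ole (Some m) m by exists m.
- by have /h[]// : ole (Some p) p by exists p.
Qed.

Lemma ole_min_inf (A : set nat) n : ole (min_inf A) n <-> exists2 m, A m & m <= n.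
Proof.
split=> [[m /min_inf_Some[Am _] le]|[m Am le]]; first by exists m.
case e: (min_inf A) => [p|].
  by have /min_inf_Some[_ minp] := e; exists p => //; exact: leq_trans (minp _ Am) le.
by have /min_inf_None A0 := e; rewrite A0 in Am.
Qed.

Lemma ole_del M I J n : ole (del M I J) n <-> exists F,
  [/\ F `<=` I `|` J, finite_set F, csize F <= n & indep M ((I `|` J) `\` F)].
Proof.
split=> [/ole_min_inf[m [F [FS cF iF]] le]|[F [FS fF le iF]]].
  by exists F; split=> //; [exists m|rewrite (csize_card cF)].
by apply/ole_min_inf; exists (csize F) => //; exists F; split=> //; exact: card_csize.
Qed.

Lemma kappa_bases M U : is_matroid M -> U `<=` ground M -> exists B B',
  [/\ basis (restrict M U) B, basis (delete M U) B' & kappa M U = del M B B'].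
Proof.
move=> mM UM; have [B bB] := basis_restrict_ex mM UM.
have [B' bB'] := basis_restrict_ex mM (@subDsetl _ (ground M) U).
rewrite /kappa; case: xgetP => [k _ [B1 [B2 [b1 b2 ->]]]|/(_ (del M B B'))[]].
  by exists B1, B2.
by exists B, B'.
Qed.

Lemma dep_finite M S A : is_matroid M -> finite_character M ->
  S `<=` ground M -> A `<=` ground M -> finite_set A ->
  (forall a, A a -> ~ indep M (S `|` [set a])) ->
  exists S0, [/\ S0 `<=` S, finite_set S0 &
    forall a, A a -> ~ indep M (S0 `|` [set a])].
Proof.
move=> mM fcM SM + fA; elim/finite_set_ind: A / fA => [_ _|A x fA Ax IH AM dep].
  by exists set0; split.
have [||S0 [S0S fS0 h]] := IH.
- by move=> y Ay; apply: AM; left.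
- by move=> a Aa; apply: dep; left.
have SxM : S `|` [set x] `<=` ground M by move=> y [/SM|->] //; apply: AM; right.
have [|F [FS fF nF]] := finite_character_dep mM fcM SxM; first by apply: dep; right.
exists (S0 `|` (F `&` S)); split.
- by move=> y [/S0S|[]].
- by rewrite finite_setU; split=> //; apply: sub_finite_set fF => y [].
move=> a [Aa|->] i; first by apply: (h a Aa); apply: (indep_subset mM i) => y [|->]; [do 2!left|right].
apply: nF; apply: (indep_subset mM i) => y Fy.
by case: (FS _ Fy) => [Sy|->]; [left; right|right].
Qed.

Lemma span_finite M U B A : is_matroid M -> finite_character M ->
  U `<=` ground M -> basis (restrict M U) B -> finite_set A -> A `<=` U ->
  exists A1, [/\ A1 `<=` B, finite_set A1 & rk M (A1 `|` A) = csize A1].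
Proof.
move=> mM fcM UM bB fA AU; have [[iB BU] _] := bB.
have fAB : finite_set (A `\` B) by exact: finite_setD.
have [|||S0 [S0B fS0 h]] := dep_finite mM fcM (S := B) (A := A `\` B) _ _ fAB.
- exact: subset_trans UM.
- by move=> x [/AU/UM].
- by move=> a [Aa Ba]; apply: (max_restrict_dep bB (AU _ Aa) Ba).
have fA1 : finite_set (S0 `|` (A `&` B)).
  by rewrite finite_setU; split=> //; apply: sub_finite_set fA => x [].
have A1B : S0 `|` (A `&` B) `<=` B by move=> x [/S0B|[]].
exists (S0 `|` (A `&` B)); split=> //.
apply: rk_max => //.
- by rewrite finite_setU.
- exact: (indep_subset mM iB).
- move=> x [//|Ax] nx i; apply: (h x).
    by split=> // Bx; apply: nx; right.
  by apply: (indep_subset mM i) => y [|->]; [do 2!left|right].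
Qed.

(** If F makes B u B' independent, finite witnesses can be enlarged to sets spanned by finite parts
    of B and B'; the union then loses at most |F| in rank. Conversely, finite parts of the
    complement of a basis of B u B' yield witnesses. *)
Lemma del_conn M U B B' n : is_matroid M -> finite_character M -> U `<=` ground M ->
  basis (restrict M U) B -> basis (delete M U) B' ->
  ole (del M B B') n <-> ~ conn M n.+1 U.
Proof.
move=> mM fcM UM bB bB'; have [[iB BU] _] := bB; have [[iB' BU'] _] := bB'.
have UM' : ground M `\` U `<=` ground M by move=> x [].
have BM := indep_ground mM iB; have BM' := indep_ground mM iB'.
have BB0 : B `&` B' = set0 by clear -BU BU'; set_solve.
have BBM : B `|` B' `<=` ground M by move=> x [/BM|/BM'].
split.
  move=> /ole_del[F [FS fF leF iF]] [A [A' [fA fA' AU AU' h]]].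
  have [A1 [A1B fA1 r1]] := span_finite mM fcM UM bB fA AU.
  have [A2 [A2B fA2 r2]] := span_finite mM fcM UM' bB' fA' AU'.
  have f1 : finite_set (A1 `|` A) by rewrite finite_setU.
  have f2 : finite_set (A2 `|` A') by rewrite finite_setU.
  have := conn_mono (rk_rank_fun mM) f1 f2 (@subsetUr _ _ _) (@subsetUr _ _ _) h.
  have f12 : finite_set (A1 `|` A2) by rewrite finite_setU.
  have c12 : csize (A1 `|` A2) = csize A1 + csize A2.
    by apply: csizeU => //; clear -A1B A2B BB0; set_solve.
  have : csize ((A1 `|` A2) `\` F) <= rk M (A1 `|` A `|` (A2 `|` A')).
    apply: rk_ge => //; first by rewrite finite_setU.
      by apply: (indep_subset mM iF); apply: setSD; exact: setUSS.
    by clear; set_solve.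
  have fD : finite_set ((A1 `|` A2) `\` F) by exact: finite_setD.
  have : csize (A1 `|` A2) <= csize ((A1 `|` A2) `\` F `|` F).
    by apply: le_csize; [rewrite finite_setU|clear; set_solve].
  have := csizeU_le fD fF; lia.
move=> nconn; have [J bJ] := basis_restrict_ex mM BBM.
have [[iJ JBB] _] := bJ.
have JM := indep_ground mM iJ.
set F := (B `|` B') `\` J.
(* A finite J0 in J spans F0. Cutting J0 u F0 along B and B' gives independent sets whose ranks
   exceed that of the union by |F0|. *)
have small F0 : F0 `<=` F -> finite_set F0 -> csize F0 <= n.
  move=> F0F fF0; rewrite leqNgt; apply/negP => lt; apply: nconn.
  have [||J0 [J0J fJ0 h]] := dep_finite mM fcM JM _ fF0.
  - by move=> x /F0F[/BBM].
  - by move=> a /F0F[Ba Ja]; exact: max_restrict_dep bJ Ba Ja.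
  have F0BB : F0 `<=` B `|` B' by move=> x /F0F[].
  have JF0 : J0 `&` F0 = set0.
    by apply/seteqP; split=> // x [/J0J Jx /F0F[]].
  have fJF : finite_set (J0 `|` F0) by rewrite finite_setU.
  have r0 : rk M (J0 `|` F0) = csize J0.
    apply: rk_max => //; first exact: (indep_subset mM iJ).
    by move=> x [//|F0x] _; exact: h.
  have fA : finite_set ((J0 `|` F0) `&` B) by apply: sub_finite_set fJF => x [].
  have fA' : finite_set ((J0 `|` F0) `&` B') by apply: sub_finite_set fJF => x [].
  exists ((J0 `|` F0) `&` B), ((J0 `|` F0) `&` B'); split=> //.
  - by move=> x [_ /BU].
  - by move=> x [_ /BU'].
  have e : (J0 `|` F0) `&` B `|` (J0 `|` F0) `&` B' = J0 `|` F0.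
    by clear -J0J JBB F0BB; set_solve.
  have iA : indep M ((J0 `|` F0) `&` B) by apply: (indep_subset mM iB) => x [].
  have iA' : indep M ((J0 `|` F0) `&` B') by apply: (indep_subset mM iB') => x [].
  have AA0 : ((J0 `|` F0) `&` B) `&` ((J0 `|` F0) `&` B') = set0.
    by clear -BB0; set_solve.
  rewrite e r0 (rk_indep mM fA iA) (rk_indep mM fA' iA') -(csizeU fA fA' AA0) e.
  by rewrite csizeU //; lia.
have fF : finite_set F.
  apply: contrapT => /(finite_subset_of_size n.+1)[F0 [F0F fF0 c]].
  by have := small _ F0F fF0; rewrite c ltnn.
apply/ole_del; exists F; split=> //; first by move=> x [].
  exact: small.
by rewrite /F setDD setIidr.
Qed.

Lemma kappa_conn M U n : is_matroid M -> finite_character M -> U `<=` ground M ->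
  ole (kappa M U) n <-> ~ conn M n.+1 U.
Proof.
move=> mM fcM UM; have [B [B' [bB bB' ->]]] := kappa_bases mM UM.
exact: del_conn.
Qed.

(** The value does not depend on the bases, since the right-hand side of [del_conn] does not mention
    them. *)
Lemma kappaE M U B B' : is_matroid M -> finite_character M -> U `<=` ground M ->
  basis (restrict M U) B -> basis (delete M U) B' -> kappa M U = del M B B'.
Proof.
move=> mM fcM UM bB bB'; apply: ole_eq => n.
by rewrite kappa_conn // (del_conn n mM fcM UM bB bB').
Qed.

Lemma ole_kappa2 M X Y n : ole (kappa2 M X Y) n <-> exists U,
  [/\ X `<=` U, U `<=` ground M `\` Y & ole (kappa M U) n].
Proof.
split=> [/ole_min_inf[m [U [XU UY k]] le]|[U [XU UY [m k le]]]].
  by exists U; split=> //; exists m.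
by apply/ole_min_inf; exists m => //; exists U.
Qed.

(** A basis K above what a finite F leaves differs from L finitely, so [basis_diff_le] bounds the
    complement of L by F. The lemma serves both M and its dual in [kappa_dual]. *)
Lemma del_basis M I J L n : is_matroid M -> basis M L -> L `<=` I `|` J ->
  ole (del M I J) n <->
  finite_set ((I `|` J) `\` L) /\ csize ((I `|` J) `\` L) <= n.
Proof.
move=> mM bL; set S := I `|` J => LS; split; last first.
  move=> [fS le]; apply/ole_del; exists (S `\` L); split=> //.
  by rewrite -/S setDD setIidr //; case: bL.
move=> /ole_del[F [FS fF le iF]].
have [K [bK FK KS]] := basis_extend mM iF bL.
have fLK : finite_set (L `\` K).
  apply: sub_finite_set fF => x [Lx Kx]; apply: contrapT => Fx.
  by apply: Kx; apply: FK; split=> //; exact: LS.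
have [fKL leKL] := basis_diff_le mM bL bK fLK.
have SKF : S `\` K `<=` F.
  by move=> x [Sx Kx]; apply: contrapT => Fx; apply: Kx; apply: FK.
have fSK := sub_finite_set SKF fF.
have fSKL : finite_set ((S `\` K) `\` L) by exact: finite_setD.
have sub : S `\` L `<=` (S `\` K) `\` L `|` (K `\` L) by clear; set_solve.
have fU : finite_set ((S `\` K) `\` L `|` (K `\` L)) by rewrite finite_setU.
split; first exact: sub_finite_set sub fU.
have LKS : L `\` K `<=` S `\` K by exact: setSD.
have := csizeD fSK LKS; have := le_csize fF SKF.
have := le_csize fU sub; have := csizeU_le fSKL fKL.
have -> : (S `\` K) `\` (L `\` K) = (S `\` K) `\` L by clear; set_solve.
lia.
Qed.

(** The dual of M*|U is the contraction of M onto U, and the last clause says that K n U is a basis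
    of it. Extending B' inside B' u K gives a basis W, which the maximality of D forces to agree
    with K on U. *)
Lemma dual_restrict_basis M U D : is_matroid M -> U `<=` ground M ->
  basis (restrict (dual M) U) D ->
  exists2 K, basis M K & D = U `\` K /\
    forall B', basis (delete M U) B' -> basis M ((K `&` U) `|` B').
Proof.
move=> mM UM [[[K bK DK] DU] maxD].
have maxU W : basis M W -> D `<=` ground M `\` W -> U `\` W = D.
  move=> bW DW; apply: maxD; first by split=> [|x []//]; exists W => // x [/UM].
  by move=> x Dx; split; [exact: DU|case: (DW _ Dx)].
exists K => //; split; first by rewrite maxU.
move=> B' bB'; have [[iB' B'U] _] := bB'.
have [W [bW BW WBK]] := basis_extend mM iB' bK.
suff -> : K `&` U `|` B' = W by [].
have WM := indep_ground mM (proj1 bW).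
have DW : D `<=` ground M `\` W.
  move=> x Dx; have [Mx Kx] := DK _ Dx; split=> // Wx.
  by case: (WBK _ Wx) => // /B'U[_]; apply; exact: DU.
have eD := maxU _ bW DW; have eK := maxU _ bK DK.
apply/seteqP; split=> x.
  move=> [[Kx Ux]|/BW//]; apply: contrapT => Wx.
  by have : (U `\` W) x by []; rewrite eD -eK => -[].
move=> Wx; have [Ux|Ux] := EM (U x).
  by left; split=> //; case: (WBK _ Wx) => // /B'U[].
right; apply: contrapT => B'x; apply: (max_restrict_dep bB' (x := x)) => //.
  by split=> //; exact: WM.
by apply: (indep_subset mM (proj1 bW)) => y [/BW|->].
Qed.

(* For dual bases D1 = U - K1 and D2 = (E - U) - K2, choosing B above K1 n U and B' above
   K2 - U makes both deletion numbers equal to the size of B' - K2. *)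
Lemma kappa_dual M U : is_matroid M -> finite_character M -> U `<=` ground M ->
  kappa (dual M) U = kappa M U.
Proof.
move=> mM fcM UM; have mD := dual_matroid mM.
have [D1 [D2 [b1 b2 ->]]] := kappa_bases mD UM.
have UM' : ground M `\` U `<=` ground M by move=> x [].
have [K1 bK1 [e1 h1]] := dual_restrict_basis mM UM b1.
have [K2 bK2 [e2 h2]] := dual_restrict_basis mM UM' b2.
have eU : delete M (ground M `\` U) = restrict M U by rewrite /delete setDD setIidr.
rewrite eU in h2.
have i1 : indep M (K1 `&` U) by apply: (indep_subset mM (proj1 bK1)) => x [].
have i2 : indep M (K2 `&` (ground M `\` U)).
  by apply: (indep_subset mM (proj1 bK2)) => x [].
have [B bB K1B] := restrict_extend mM i1 (@subIsetr _ _ _).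
have [B' bB' K2B'] := restrict_extend mM i2 (@subIsetr _ _ _).
have [[iB BU] _] := bB; have [[iB' B'U] _] := bB'.
rewrite (kappaE mM fcM UM bB bB').
have bL := h1 _ bB'; have bL2 := h2 _ bB.
have LM := indep_ground mM (proj1 bL).
have K1M := indep_ground mM (proj1 bK1).
have K2M := indep_ground mM (proj1 bK2).
set L := _ `|` _ in bL LM; set L2 := _ `|` _ in bL2.
have bDL : basis (dual M) (ground M `\` L).
  by apply/(basis_dual _ mM); rewrite setDD setIidr //; split=> // x [].
have sD : ground M `\` L `<=` D1 `|` D2.
  move=> x [Mx Lx]; have [Ux|Ux] := EM (U x).
    by left; rewrite e1; split=> // Kx; apply: Lx; left.
  by right; rewrite e2; split=> // Kx; apply: Lx; right; apply: K2B'.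
have sL2 : L2 `<=` B `|` B' by move=> x [/K2B'|]; [right|left].
apply: ole_eq => n; rewrite (del_basis n mD bDL sD) (del_basis n mM bL2 sL2).
suff -> : (D1 `|` D2) `\` (ground M `\` L) = (B `|` B') `\` L2 by [].
rewrite e1 e2 /L /L2; clear -BU B'U UM K1B K2B'.
by set_solve.
Qed.

Lemma kappa2_dual M X Y : is_matroid M -> finite_character M ->
  kappa2 (dual M) X Y = kappa2 M X Y.
Proof.
move=> mM fcM; apply: ole_eq => n; rewrite !ole_kappa2 /=.
by split=> -[U [XU UY h]]; exists U; split=> //; move: h;
  rewrite kappa_dual // => x /UY[].
Qed.

End Kappa.

(** * Ranks and connectivity in M/C - D for independent C *)

Section Minor.
Variables (T : Type) (M : indep_system T) (C D : set T).
Hypotheses (mM : is_matroid M) (fcM : finite_character M) (iC : indep M C).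
Implicit Types (A B F I J K L S U X Y : set T).

Let N := delete (contract M C) D.

Lemma minor_indepP I : indep N I <->
  I `<=` (ground M `\` C) `\` D /\ indep M (I `|` C).
Proof.
rewrite -[indep N I]/(indep (contract M C) I /\ I `<=` (ground M `\` C) `\` D).
rewrite contract_indepP //.
split=> [[[_ iI] ID]|[ID iI]]; first by split.
by split=> //; split=> //; clear -ID; set_solve.
Qed.

Lemma minor_matroid : is_matroid N.
Proof. by apply: delete_matroid; exact: contract_matroid. Qed.

Lemma minor_finite_character : finite_character N.
Proof.
move=> S /= SN iF; apply/minor_indepP; split=> //; apply: fcM.
  by move=> x [/SN[[]]//|]; exact: (indep_ground mM iC).
move=> F FS fF.
have fFS : finite_set (F `&` S) by apply: sub_finite_set fF => x [].
have /minor_indepP[_ i] := iF _ (@subIsetr _ F S) fFS.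
by apply: (indep_subset mM i) => x Fx; case: (FS _ Fx) => ?; [left|right].
Qed.

(** Together with [rk_minor_ge]: for finite A in N, the rank in N is the minimum of r(A u C0) - |C0|
    over finite C0 in C, even when C is infinite. *)
Lemma rk_minor_le A C0 : finite_set A -> finite_set C0 -> C0 `<=` C ->
  rk N A + csize C0 <= rk M (A `|` C0).
Proof.
move=> fA fC0 C0C; have [K [[/minor_indepP[KN iK] KA] _] ->] := rk_basis minor_matroid A.
have fK := sub_finite_set KA fA.
rewrite -csizeU //; last by clear -KN C0C; set_solve.
apply: rk_ge => //; [by rewrite finite_setU| |exact: setSU].
by apply: (indep_subset mM iK); exact: setUS.
Qed.

Lemma rk_minor_ge A : finite_set A -> A `<=` ground N ->
  exists C0, [/\ C0 `<=` C, finite_set C0 & rk M (A `|` C0) <= rk N A + csize C0].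
Proof.
move=> fA AN; have [K bK ->] := rk_basis minor_matroid A.
have [[/minor_indepP[KN iK] KA] _] := bK.
have fK := sub_finite_set KA fA.
have fAK : finite_set (A `\` K) by exact: finite_setD.
have KCM := indep_ground mM iK.
have [||S0 [S0K fS0 h]] := dep_finite mM fcM KCM _ fAK.
- by move=> x [/AN[[]]].
- move=> a [Aa Ka] i; apply: (max_restrict_dep bK Aa Ka); apply/minor_indepP.
  split; first by move=> x [/KN|->] //; exact: AN.
  by rewrite setUAC.
have fC0 : finite_set (S0 `&` C) by apply: sub_finite_set fS0 => x [].
exists (S0 `&` C); split=> //.
rewrite (rk_max mM (K := K `|` (S0 `&` C))).
- exact: csizeU_le.
- by rewrite finite_setU.
- by apply: (indep_subset mM iK); apply: setUS => x [].
- exact: setSU.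
- move=> x [Ax|Cx] nx i; last by apply: nx; right.
  apply: (h x); first by split=> // Kx; apply: nx; left.
  apply: (indep_subset mM i) => y [S0y|->]; last by right.
  by left; case: (S0K _ S0y) => ?; [left|right].
Qed.

(** Take the finite C0 that attains the rank of A u B in N and split it along U: the part inside
    joins A, the part outside joins B. *)
Lemma minor_conn k X Y U : ground N = X `|` Y -> conn N k X ->
  X `<=` U -> U `<=` ground M `\` Y -> conn M k U.
Proof.
move=> eN [A [B [fA fB AX BY h]]] XU UY.
have fAB : finite_set (A `|` B) by rewrite finite_setU.
have [|C0 [C0C fC0 r0]] := rk_minor_ge fAB.
  by rewrite eN; move=> x [/AX|/BY[]]; [left|rewrite eN].
have f1 : finite_set (C0 `&` U) by apply: sub_finite_set fC0 => x [].
have f2 : finite_set (C0 `\` U) by exact: finite_setD.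
have C1C : C0 `&` U `<=` C by move=> x [/C0C].
have C2C : C0 `\` U `<=` C by move=> x [/C0C].
have r1 := rk_minor_le fA f1 C1C; have r2 := rk_minor_le fB f2 C2C.
have CM := indep_ground mM iC.
have NM : ground N `<=` ground M by move=> x [[]].
exists (A `|` (C0 `&` U)), (B `|` (C0 `\` U)); split.
- by rewrite finite_setU.
- by rewrite finite_setU.
- by move=> x [/AX/XU|[]].
- move=> x [/BY[Nx Xx]|[/C0C/CM]] //; split; first exact: NM.
  by move=> /UY[_]; apply; move: Nx; rewrite eN => -[].
have -> : A `|` (C0 `&` U) `|` (B `|` (C0 `\` U)) = A `|` B `|` C0.
  by clear; set_solve.
have := csizeU f1 f2; rewrite setUIDK => c0.
have : csize C0 = csize (C0 `&` U) + csize (C0 `\` U) by apply: c0; clear; set_solve.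
lia.
Qed.

Lemma conn_minor k X Y I J C0 : ground N = X `|` Y -> X `&` Y = set0 ->
  finite_set I -> finite_set J -> finite_set C0 ->
  I `<=` X -> J `<=` Y -> C0 `<=` C ->
  indep M (I `|` C) -> indep M (J `|` C) ->
  k + rk M (I `|` J `|` C0) <= csize I + csize J + csize C0 -> conn N k X.
Proof.
move=> eN XY0 fI fJ fC0 IX JY C0C iI iJ h.
exists I, J; split=> //.
  by rewrite eN; clear -JY XY0; set_solve.
have IN : I `<=` ground N by rewrite eN; clear -IX; set_solve.
have JN : J `<=` ground N by rewrite eN; clear -JY; set_solve.
have nI : indep N I by apply/minor_indepP.
have nJ : indep N J by apply/minor_indepP.
rewrite (rk_indep minor_matroid fI nI) (rk_indep minor_matroid fJ nJ).
have fIJ : finite_set (I `|` J) by rewrite finite_setU.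
have := rk_minor_le fIJ fC0 C0C; lia.
Qed.

End Minor.

(** * The linking theorem under finite character, and the dual case *)

Lemma finite_character_linking (T : Type) (M : indep_system T) (X Y : set T) :
  is_matroid M -> finite_character M -> X `<=` ground M -> Y `<=` ground M ->
  X `&` Y = set0 ->
  exists C D : set T, indep M C /\
    [/\ C `|` D = ground M `\` (X `|` Y), C `&` D = set0
      & kappa2 (delete (contract M C) D) X Y = kappa2 M X Y].
Proof.
move=> mM fcM XM YM XY0.
have [C [CE iC hC]] := contraction_set mM XM YM XY0 fcM.
pose D := (ground M `\` (X `|` Y)) `\` C.
exists C, D; split=> //; split.
- by rewrite /D; clear -CE; set_solve.
- by rewrite /D; clear; set_solve.
set N := delete _ _.
have eN : ground N = X `|` Y by rewrite /= /D; clear -XM YM CE; set_solve.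
have mN : is_matroid N by exact: minor_matroid.
have fcN : finite_character N by exact: minor_finite_character.
have XN : X `<=` ground N by rewrite eN; left.
apply: ole_eq => n; rewrite !ole_kappa2; split.
  move=> [U [XU UY k]].
  have eU : U = X by rewrite eN in UY; clear -XU UY; set_solve.
  rewrite eU kappa_conn // in k.
  have /existsNP[V /not_implyP[XV /not_implyP[VY nc]]] : ~ separated M X Y n.+1.
    move=> /hC[I [J [C0 [[fI fJ fC0] [[IX JY C0C] [iI iJ h]]]]]].
    apply: k; exact: (conn_minor mM iC eN XY0 fI fJ fC0 IX JY C0C iI iJ h).
  exists V; split=> //; apply/kappa_conn => //; by move=> x /VY[].
move=> [U [XU UY k]]; rewrite kappa_conn // in k; last by move=> x /UY[].
exists X; split=> //; first by rewrite eN; clear -XY0; set_solve.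
apply/kappa_conn => // c; apply: k; exact: minor_conn eN c XU UY.
Qed.

(** Needed to recognise the dual of M/D - C as M*/C - D. It requires C independent, which is why
    [finite_character_linking] keeps this in its conclusion. *)
Lemma contract_delete_comm (T : Type) (M : indep_system T) (C D : set T) :
  is_matroid M -> indep M C -> C `&` D = set0 ->
  contract (delete M D) C = delete (contract M C) D.
Proof.
move=> mM iC CD0; have mD : is_matroid (delete M D) by exact: delete_matroid.
have CM := indep_ground mM iC.
have iCD : indep (delete M D) C by split=> //; clear -CM CD0; set_solve.
apply: indep_system_eq => [|I]; first by rewrite /=; clear; set_solve.
rewrite contract_indepP // minor_indepP //=; split.
  move=> [IC0 [i ID]]; split=> //; clear -IC0 ID; set_solve.
by move=> [ID i]; split; [|split=> //]; clear -ID CM CD0; set_solve.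
Qed.

Theorem theorem2 (T : Type) (M : indep_system T) (X Y : set T)
  (hM : is_matroid M)
  (hfin : finitary M \/ cofinitary M)
  (hX : X `<=` ground M) (hY : Y `<=` ground M)
  (hXY : X `&` Y = set0) :
  exists C D : set T,
    [/\ C `|` D = ground M `\` (X `|` Y),
        C `&` D = set0
      & kappa2 (delete (contract M C) D) X Y = kappa2 M X Y].
Proof.
case: hfin => [/(finitary_finite_character hM) fcM|].
  by have [C [D [_ h]]] := finite_character_linking hM fcM hX hY hXY; exists C, D.
set P := dual M; have mP : is_matroid P by exact: dual_matroid.
move=> /(finitary_finite_character mP) fcP.
have [C [D [iC [eCD CD0 k]]]] := finite_character_linking mP fcP hX hY hXY.
(* Duality exchanges contraction and deletion, so the set contracted in the dual is deleted in M. *)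
exists D, C; split; [by rewrite setUC|by rewrite setIC|].
set N := delete (contract M D) C.
have mN : is_matroid N by exact/delete_matroid/contract_matroid.
have eN : dual N = delete (contract P C) D.
  by rewrite -contract_delete_comm // /contract dual_dual //; exact: delete_matroid.
(* [kappa2_dual] needs finite character, so it is applied to the dual minor and to [P], not to [N]
   and [M]. *)
rewrite -(dual_dual mN) eN kappa2_dual; first last.
- exact: minor_finite_character.
- exact: minor_matroid.
by rewrite k -[in RHS](dual_dual hM) kappa2_dual.
Qed.
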